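(* Let $n\ge 1$ and let $E_{\mathrm{in}}=\mathbb{S}^{n-1}\subset\mathbb{R}^n$ be the unit sphere. Let $E_{\mathrm{out}}\subset\mathbb{R}^n$ be a nondegenerate ellipsoid centered at the origin. Let $A$ be the unique positive definite real symmetric matrix such that $A E_{\mathrm{out}}=E_{\mathrm{in}}$. Let $\mathcal{S}_f(E_{\mathrm{in}},E_{\mathrm{out}})$ (resp. $\mathcal{S}_t(E_{\mathrm{in}},E_{\mathrm{out}})$) be the set of labeled simplices fitting (resp. fitting tightly) between $E_{\mathrm{out}}$ and $E_{\mathrm{in}}$, and let $\phi:\mathcal{S}_f(E_{\mathrm{in}},E_{\mathrm{out}})\to O(n)$ be the map taking a simplex with vertices $v_1,\ldots,v_n,v_{n+1}$ to the matrix $Q\in O(n)$ whose columns are obtained from the basis $v_1,\ldots,v_n$ by Gram-Schmidt orthonormalization. (i) If $\operatorname{tr}(A)>1$, no simplex fits between $E_{\mathrm{in}}$ and $E_{\mathrm{out}}$: $\mathcal{S}_f(E_{\mathrm{in}},E_{\mathrm{out}})=\varnothing$. (ii) If $\operatorname{tr}(A)=1$, every fitting simplex fits tightly: $\mathcal{S}_f(E_{\mathrm{in}},E_{\mathrm{out}})=\mathcal{S}_t(E_{\mathrm{in}},E_{\mathrm{out}})$. The map $\phi:\mathcal{S}_f(E_{\mathrm{in}},E_{\mathrm{out}})\to O(n)$ is a diffeomorphism. (iii) If $\operatorname{tr}(A)<1$, then $\mathcal{S}_t(E_{\mathrm{in}},E_{\mathrm{out}})\ne\mathcal{S}_f(E_{\mathrm{in}},E_{\mathrm{out}})$.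 The map $\phi:\mathcal{S}_f(E_{\mathrm{in}},E_{\mathrm{out}})\to O(n)$ is surjective and not injective.
   Context: $\operatorname{conv}$ denotes convex hull and $O(n)$ the real orthogonal group. A simplex in $\mathbb{R}^n$ is a convex polytope with $n+1$ vertices and nonempty interior; a labeled simplex is one whose vertices are indexed $v_1,\ldots,v_{n+1}$, so that the set of labeled simplices is regarded as a subset of $(\mathbb{R}^n)^{n+1}$. A closed convex polytope $P\subset\mathbb{R}^n$ fits between $E_{\mathrm{out}}$ and $E_{\mathrm{in}}$ if $E_{\mathrm{in}}\subset P\subset\operatorname{conv}(E_{\mathrm{out}})$. It is inscribed in $E_{\mathrm{out}}$ if all its vertices belong to $E_{\mathrm{out}}$, and circumscribed to $E_{\mathrm{in}}$ if all its hyperfaces (facets) are tangent to $E_{\mathrm{in}}$. It fits tightly if it fits, is inscribed in $E_{\mathrm{out}}$ and is circumscribed to $E_{\mathrm{in}}$. ''Diffeomorphism'' means a bijection which is smooth with smooth inverse, where the sets of labeled simplices are viewed inside $(\mathbb{R}^n)^{n+1}$. For a fitting simplex the origin is in its interior, so $v_1,\ldots,v_n$ is indeed a basis. *)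

(* Defs.v *)
From mathcomp Require Import all_boot all_order all_algebra.
From mathcomp Require Import all_classical all_reals all_analysis.

Set Implicit Arguments.
Unset Strict Implicit.
Unset Printing Implicit Defensive.

Import Order.TTheory GRing.Theory Num.Theory.
Import numFieldNormedType.Exports.

Local Open Scope classical_set_scope.
Local Open Scope ring_scope.

(* Points of R^n are column vectors.  Euclidean lengths are always expressed
   through [dot]: the library norm of a matrix is the sup norm, which is used
   below only for the topology and the differential calculus. *)

Definition dot (R : realType) (n : nat) (x y : 'cV[R]_n) : R :=
  (x^T *m y) ord0 ord0.

Definition unit_sphere (R : realType) (n : nat) : set 'cV[R]_n :=
  [set x | dot x x = 1].

Definition centered_ellipsoid (R : realType) (n : nat) (E : set 'cV[R]_n) :
    Prop :=
  exists2 B : 'M[R]_n, B \in unitmx & E = [set B *m x | x in @unit_sphere R n].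

Definition symmetric_posdef (R : realType) (n : nat) (A : 'M[R]_n) : Prop :=
  A^T = A /\ forall x : 'cV[R]_n, x != 0 -> 0 < dot x (A *m x).

Definition orthogonal_group (R : realType) (n : nat) : set 'M[R]_n :=
  [set Q | Q^T *m Q = 1%:M].

Definition convex_hull (R : realType) (n : nat) (X : set 'cV[R]_n) :
    set 'cV[R]_n :=
  smallest (@convex_set R 'cV[R]_n) X.

Definition vertices (R : realType) (n : nat) (P : set 'cV[R]_n) :
    set 'cV[R]_n :=
  [set x | P x /\ forall (y z : 'cV[R]_n) (t : R), P y -> P z ->
     0 < t < 1 -> x = t *: y + (1 - t) *: z -> y = z].

Definition affinely_independent (R : realType) (n k : nat)
    (W : 'M[R]_(n, k)) : Prop :=
  forall c : 'cV[R]_k, \sum_i c i ord0 = 0 -> W *m c = 0 -> c = 0.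

(* F is the intersection of P with a supporting hyperplane and has affine
   dimension n - 1; as F lies in a hyperplane, this amounts to F containing n
   affinely independent points. *)
Definition facet (R : realType) (n : nat) (P F : set 'cV[R]_n) : Prop :=
  exists (u : 'cV[R]_n) (c : R),
    [/\ u != 0,
        forall x, P x -> dot u x <= c,
        F = [set x | P x /\ dot u x = c]
      & exists W : 'M[R]_n,
          affinely_independent W /\ forall j, F (col j W)].

(* Tangent vectors to E at p: velocities at p of curves drawn on E. *)
Definition tangent_vector (R : realType) (n : nat) (E : set 'cV[R]_n)
    (p v : 'cV[R]_n) : Prop :=
  exists gamma : R -> 'cV[R]_n,
    [/\ forall t, E (gamma t), gamma 0 = p & is_derive (0 : R) 1 gamma v].

(* For a facet F of affine dimension n - 1 and a hypersurface E, the inclusion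
   of F in p + T_p E means that F spans the tangent hyperplane of E at p. *)
Definition facet_tangent (R : realType) (n : nat) (E F : set 'cV[R]_n) : Prop :=
  exists p : 'cV[R]_n,
    [/\ F p, E p & forall x, F x -> tangent_vector E p (x - p)].

Definition fits (R : realType) (n : nat) (Ein Eout P : set 'cV[R]_n) : Prop :=
  Ein `<=` P /\ P `<=` convex_hull Eout.

Definition inscribed (R : realType) (n : nat) (Eout P : set 'cV[R]_n) : Prop :=
  vertices P `<=` Eout.

Definition circumscribed (R : realType) (n : nat) (Ein P : set 'cV[R]_n) :
    Prop :=
  forall F, facet P F -> facet_tangent Ein F.

Definition fits_tightly (R : realType) (n : nat) (Ein Eout P : set 'cV[R]_n) :
    Prop :=
  [/\ fits Ein Eout P, inscribed Eout P & circumscribed Ein P].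

(* An element of (R^n)^(n+1) is a matrix whose columns are v_1, ..., v_(n+1). *)
Definition hull_of_columns (R : realType) (n : nat) (V : 'M[R]_(n, n.+1)) :
    set 'cV[R]_n :=
  convex_hull (range (fun j => col j V)).

Definition labeled_simplex (R : realType) (n : nat) (V : 'M[R]_(n, n.+1)) :
    Prop :=
  set_bij [set: 'I_n.+1] (vertices (hull_of_columns V)) (fun j => col j V) /\
  interior (hull_of_columns V) !=set0.

Definition fitting_simplices (R : realType) (n : nat)
    (Ein Eout : set 'cV[R]_n) : set 'M[R]_(n, n.+1) :=
  [set V | labeled_simplex V /\ fits Ein Eout (hull_of_columns V)].

Definition tight_simplices (R : realType) (n : nat)
    (Ein Eout : set 'cV[R]_n) : set 'M[R]_(n, n.+1) :=
  [set V | labeled_simplex V /\ fits_tightly Ein Eout (hull_of_columns V)].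

Definition gram_schmidt_step (R : realType) (n : nat) (qs : seq 'cV[R]_n)
    (v : 'cV[R]_n) : seq 'cV[R]_n :=
  let u := v - \sum_(q <- qs) dot q v *: q in
  rcons qs ((Num.sqrt (dot u u))^-1 *: u).

Definition gram_schmidt (R : realType) (n : nat) (M : 'M[R]_n) : 'M[R]_n :=
  let qs := foldl (@gram_schmidt_step R n) [::]
              [seq col j M | j <- enum 'I_n] in
  \matrix_(i, j) (nth 0 qs j) i ord0.

Definition simplex_frame (R : realType) (n : nat) (V : 'M[R]_(n, n.+1)) :
    'M[R]_n :=
  gram_schmidt (col' ord_max V).

(* C^k on an open set U of a finite-dimensional space; values of f outside U
   are irrelevant. *)
Fixpoint Ck_on (R : realType) (V W : normedModType R) (k : nat) (U : set V)
    (f : V -> W) : Prop :=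
  if k is k'.+1 then
    (forall x, U x -> differentiable f x) /\
    forall v : V, Ck_on k' U (fun x => 'D_v f x)
  else forall x, U x -> {for x, continuous f}.

(* Smoothness on an arbitrary subset X: locally, f extends to a C^oo map on an
   open set of the ambient space. *)
Definition smooth_on (R : realType) (V W : normedModType R) (X : set V)
    (f : V -> W) : Prop :=
  forall x, X x -> exists (U : set V) (F : V -> W),
    [/\ open U, U x, forall k, Ck_on k U F
      & forall y, U y -> X y -> F y = f y].

Definition diffeomorphism (R : realType) (V W : normedModType R) (X : set V)
    (Y : set W) (f : V -> W) : Prop :=
  [/\ set_bij X Y f, smooth_on X f
    & exists2 g : W -> V, forall x, X x -> g (f x) = x & smooth_on Y g].

(* Main.v *)
Require Import Defs.
From mathcomp Require Import all_boot all_order all_algebra.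
From mathcomp Require Import all_classical all_reals all_analysis.
From mathcomp Require Import ring lra.

Set Implicit Arguments.
Unset Strict Implicit.
Unset Printing Implicit Defensive.

Import Order.TTheory GRing.Theory Num.Theory.
Import numFieldNormedType.Exports.

Local Open Scope classical_set_scope.
Local Open Scope ring_scope.

(** With barycentric coordinates l_i + <w_i, x> relative to the vertices v_i, the
    unit sphere lies in the simplex iff |w_i| <= l_i, and the simplex lies in
    conv(E_out) iff |A v_i| <= 1.  As sum_i v_i w_i^T = 1 and sum_i l_i = 1,
      tr A = sum_i <w_i, A v_i> <= sum_i |w_i| |A v_i| <= sum_i l_i = 1,
    and tr A = 1 forces w_i = l_i A v_i and |A v_i| = 1, i.e. tightness, and
    <v_i, A v_j> = -1 for i != j.

    In other words the lifted vertices (v_i, 1) are orthogonal for A + 1 and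
    isotropic for the form |A x|^2 - h^2, whose trace relative to A + 1 is
    tr A - 1.  When this trace is 0 and a flag is given, such vectors are found
    one at a time: if a_0, ..., a_(n-1) is the A-orthonormal basis adapted to the
    flag, v_k is the only admissible isotropic vector in the plane spanned by a_k
    and the vector (P_k, 1) orthogonal to the previous ones, and P_(k+1) is
    orthogonal to it in the same plane.  This inverts phi by a formula which uses
    only field operations and square roots of positive quantities.  The case
    tr A < 1 is reduced to A / tr A. *)

(** * Smoothness of elementary functions *)

(** Differentiability depends on the germ only: the first-order expansion of [f] at [x] is also one
    of [g], and [diff_unique] identifies the differentials. *)
Lemma near_eq_differentiable (R : realType) (V W : normedModType R)
    (f g : V -> W) (x : V) :
  (\forall y \near x, f y = g y) -> differentiable f x -> differentiable g x.
Proof.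
move=> fg df; have fgx : f x = g x by exact: (nbhs_singleton fg).
have [dfc /eqaddoP dfo] := (diff_locallyP _ _).1 df.
have dgo : g \o shift x = cst (g x) + 'd f x +o_ 0 id.
  have fg0 : \forall h \near (0 : V), f (h + x) = g (h + x).
    have : (fun h : V => h + x) @ 0 --> x.
      rewrite -[X in _ --> X]add0r; apply: cvgD; [exact: cvg_id|exact: cvg_cst].
    by move=> /(_ _ fg).
  apply/eqaddoP => e e0; near=> h.
  have fgh : f (h + x) = g (h + x) by near: h.
  have : `|(f \o shift x - (cst (f x) + 'd f x)) h| <= e * `|h|.
    by near: h; exact: dfo.
  by rewrite !fctE /= /shift /= fgx fgh.
apply/diff_locallyP; have dE := diff_unique dfc dgo.
by split; rewrite dE //; exact: dgo.
Unshelve. all: by end_near. Qed.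

(* Unlike [Ck_on], this class contains the derivatives of its members, so that
   smoothness needs no induction on the order beyond [mx_elementary_Ck]. *)
Inductive elementary (R : realType) (V : normedModType R) (U : set V) :
    (V -> R) -> Prop :=
| elem_cst c : elementary U (fun _ => c)
| elem_lin (f : V -> R) : (forall x, differentiable f x) ->
    (forall x v, 'D_v f x = f v) -> elementary U f
| elem_add f g : elementary U f -> elementary U g ->
    elementary U (fun x => f x + g x)
| elem_mul f g : elementary U f -> elementary U g ->
    elementary U (fun x => f x * g x)
| elem_inv f : (forall x, U x -> f x != 0) -> elementary U f ->
    elementary U (fun x => (f x)^-1)
| elem_sqrt f : (forall x, U x -> 0 < f x) -> elementary U f ->
    elementary U (fun x => Num.sqrt (f x))
| elem_ext f g : (forall x, U x -> f x = g x) -> elementary U f ->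
    elementary U g.

Section Elementary.
Variables (R : realType) (V : normedModType R) (U : set V).
Hypothesis openU : open U.
Implicit Types f g : V -> R.

Lemma near_open (x : V) (P : V -> Prop) :
  (forall y, U y -> P y) -> U x -> \forall y \near x, P y.
Proof.
move=> UP Ux; have : nbhs x U by rewrite nbhsE /=; exists U.
exact: filterS.
Qed.

(** Each differentiation rule writes the derivative with the constructors again. Openness of [U]
    enters in the case [elem_ext], where equality on [U] must become equality near each point. *)
Lemma elementary_derive f : elementary U f ->
  (forall x, U x -> differentiable f x) /\
  forall v, elementary U (fun x => 'D_v f x).
Proof.
elim=> {f}.
- move=> c; split=> [x _|v]; first exact: differentiable_cst.
  apply: (@elem_ext _ _ _ (fun=> 0)); last exact: elem_cst.
  by move=> x _; rewrite derive_cst.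
- move=> f df Df; split=> // v.
  by apply: (@elem_ext _ _ _ (fun=> f v)); [move=> x _; rewrite Df|exact: elem_cst].
- move=> f g _ [df Df] _ [dg Dg]; split=> [x Ux|v].
    by apply: differentiableD; [exact: df|exact: dg].
  apply: (elem_ext _ (elem_add (Df v) (Dg v))) => x Ux.
  by rewrite -deriveD //; apply: diff_derivable; [exact: df|exact: dg].
- move=> f g ef [df Df] eg [dg Dg]; split=> [x Ux|v].
    by apply: differentiableM; [exact: df|exact: dg].
  apply: (elem_ext _ (elem_add (elem_mul ef (Dg v)) (elem_mul eg (Df v)))) => x Ux.
  by rewrite -[LHS]deriveM //; apply: diff_derivable; [exact: df|exact: dg].
- move=> f f0 ef [df Df]; split=> [x Ux|v].
    by apply: differentiableV; [exact: df|exact: f0].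
  have e2 : elementary U (fun x => (f x * f x)^-1).
    apply: elem_inv; last exact: elem_mul.
    by move=> x Ux; rewrite mulf_neq0 ?f0.
  apply: (elem_ext _ (elem_mul (elem_cst U (-1)) (elem_mul e2 (Df v)))) => x Ux.
  rewrite deriveV ?f0 //; last by apply: diff_derivable; exact: df.
  by rewrite expr2 mulN1r /GRing.scale /= mulNr.
- move=> f f0 ef [df Df].
  have ds x : U x -> differentiable (@Num.sqrt R) (f x).
    move=> Ux; apply/derivable1_diffP; apply: ex_derive.
    by apply: is_derive1_sqrt; exact: f0.
  split=> [x Ux|v].
    by apply: (differentiable_comp (df _ Ux)); exact: ds.
  have es : elementary U (fun x => Num.sqrt (f x)) by exact: elem_sqrt.
  have e2 : elementary U (fun x => (2 * Num.sqrt (f x))^-1).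
    apply: elem_inv; last by apply: elem_mul => //; exact: elem_cst.
    by move=> x Ux; rewrite mulf_neq0 // gt_eqF // sqrtr_gt0 f0.
  apply: (elem_ext _ (elem_mul e2 (Df v))) => x Ux.
  rewrite [RHS]deriveE; last exact: (differentiable_comp (df _ Ux) (ds _ Ux)).
  rewrite (diff_comp (df _ Ux) (ds _ Ux)) /=.
  have -> : 'd (@Num.sqrt R) (f x) ('d f x v)
          = 'd f x v *: 'd (@Num.sqrt R) (f x) (1 : R).
    by rewrite -linearZ /= /GRing.scale /= mulr1.
  rewrite -(deriveE _ (ds _ Ux)) -(deriveE _ (df _ Ux)).
  have := is_derive1_sqrt (f0 x Ux) => h.
  by rewrite (@derive_val _ _ _ _ _ _ _ h) /GRing.scale /= mulrC.
- move=> f g fg ef [df Df]; split=> [x Ux|v].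
    by apply: near_eq_differentiable (df _ Ux); exact: near_open.
  apply: (elem_ext _ (Df v)) => x Ux.
  by apply: near_eq_derive; exact: near_open.
Qed.

Definition mx_elementary m n (F : V -> 'M[R]_(m, n)) :=
  forall i j, elementary U (fun x => F x i j).

Lemma mx_elementary_differentiable m n (F : V -> 'M[R]_(m, n)) x :
  mx_elementary F -> U x -> differentiable F x.
Proof.
move=> eF Ux.
have -> : F = \sum_(i < m) \sum_(j < n) (fun y => F y i j *: delta_mx i j).
  apply/funext => y; rewrite fct_sumE [LHS]matrix_sum_delta.
  by apply: eq_bigr => i _; rewrite fct_sumE.
apply: differentiable_sum => i; apply: differentiable_sum => j.
apply: differentiableZl.
by have [+ _] := elementary_derive (eF i j); apply.
Qed.

Lemma mx_elementary_Ck m n (F : V -> 'M[R]_(m, n)) k :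
  mx_elementary F -> Ck_on k U F.
Proof.
elim: k F => [|k IH] F eF /=.
  by move=> x Ux; apply: differentiable_continuous; exact: mx_elementary_differentiable.
split=> [x Ux|v]; first exact: mx_elementary_differentiable.
apply: IH => i j; have [_ /(_ v)] := elementary_derive (eF i j).
apply: elem_ext => x Ux.
by rewrite derive_mx ?mxE //; apply: diff_derivable; exact: mx_elementary_differentiable.
Qed.

Lemma elem_sum (I : Type) (r : seq I) (P : pred I) (f : I -> V -> R) :
  (forall i, P i -> elementary U (f i)) ->
  elementary U (fun x => \sum_(i <- r | P i) f i x).
Proof.
move=> ef; elim: r => [|i r IH].
  by apply: elem_ext (elem_cst U 0) => x _; rewrite big_nil.
have [Pi|nPi] := boolP (P i).
  by apply: elem_ext (elem_add (ef _ Pi) IH) => x _; rewrite big_cons Pi.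
by apply: elem_ext IH => x _; rewrite big_cons (negPf nPi).
Qed.

Lemma elem_opp f : elementary U f -> elementary U (fun x => - f x).
Proof.
move=> ef; apply: elem_ext (elem_mul (elem_cst U (-1)) ef) => x _.
by rewrite mulN1r.
Qed.

Lemma mx_elementary_cst m n (M : 'M[R]_(m, n)) : mx_elementary (fun=> M).
Proof. by move=> i j; exact: elem_cst. Qed.

Lemma mx_elementary_add m n (F G : V -> 'M[R]_(m, n)) :
  mx_elementary F -> mx_elementary G -> mx_elementary (fun x => F x + G x).
Proof.
move=> eF eG i j; apply: elem_ext (elem_add (eF i j) (eG i j)) => x _.
by rewrite mxE.
Qed.

Lemma mx_elementary_opp m n (F : V -> 'M[R]_(m, n)) :
  mx_elementary F -> mx_elementary (fun x => - F x).
Proof. by move=> eF i j; apply: elem_ext (elem_opp (eF i j)) => x _; rewrite mxE. Qed.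

Lemma mx_elementary_scale m n f (F : V -> 'M[R]_(m, n)) :
  elementary U f -> mx_elementary F -> mx_elementary (fun x => f x *: F x).
Proof.
by move=> ef eF i j; apply: elem_ext (elem_mul ef (eF i j)) => x _; rewrite mxE.
Qed.

Lemma mx_elementary_mul m n p (F : V -> 'M[R]_(m, n)) (G : V -> 'M[R]_(n, p)) :
  mx_elementary F -> mx_elementary G -> mx_elementary (fun x => F x *m G x).
Proof.
move=> eF eG i j.
have /(elem_ext _) : elementary U (fun x => \sum_k F x i k * G x k j).
  by apply: elem_sum => k _; exact: elem_mul.
by apply=> x _; rewrite mxE.
Qed.

Lemma mx_elementary_sum (I : Type) (r : seq I) (P : pred I) m n
    (F : I -> V -> 'M[R]_(m, n)) :
  (forall i, P i -> mx_elementary (F i)) ->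
  mx_elementary (fun x => \sum_(i <- r | P i) F i x).
Proof.
move=> eF i j.
have /(elem_ext _) : elementary U (fun x => \sum_(k <- r | P k) F k x i j).
  by apply: elem_sum => k Pk; exact: eF.
by apply=> x _; rewrite summxE.
Qed.

Lemma elem_dot n (F G : V -> 'cV[R]_n) :
  mx_elementary F -> mx_elementary G -> elementary U (fun x => dot (F x) (G x)).
Proof.
move=> eF eG; apply: (mx_elementary_mul (F := fun x => (F x)^T)) => // i j.
by apply: elem_ext (eF j i) => x _; rewrite mxE.
Qed.

End Elementary.

Lemma elem_coord (R : realType) m n (U : set 'M[R]_(m, n)) i j :
  elementary U (fun M : 'M[R]_(m, n) => M i j).
Proof.
apply: elem_lin => [x|x v]; first exact: differentiable_coord.
have /matrixP/(_ i j) := derive_mx (@derivable_id _ _ x v).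
by rewrite derive_id mxE => ->.
Qed.

Lemma mx_elementary_id (R : realType) m n (U : set 'M[R]_(m, n)) :
  mx_elementary U id.
Proof. by move=> i j; exact: elem_coord. Qed.

(** The determinant is a polynomial in the entries, hence continuous. The form with [mxsub] covers
    both invertible square matrices and labeled simplices whose first n vertices form a basis. *)
Lemma open_unitmx_preimage (R : realType) m n p (f : 'I_p -> 'I_m)
    (g : 'I_p -> 'I_n) :
  open [set M : 'M[R]_(m, n) | mxsub f g M \in unitmx].
Proof.
have -> : [set M : 'M[R]_(m, n) | mxsub f g M \in unitmx] =
    (fun M => \det (mxsub f g M)) @^-1` [set x : R | x != 0].
  by apply/seteqP; split=> M; rewrite /= unitmxE unitfE.
apply: open_comp; last exact: open_neq.
move=> M _; apply: differentiable_continuous.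
suff /(elementary_derive openT) [dd _] :
  elementary setT (fun M : 'M[R]_(m, n) => \det (mxsub f g M)).
  exact: dd.
rewrite /determinant; apply: elem_sum => s _; apply: elem_mul.
  exact: elem_cst.
elim: (index_enum _) => [|i r IH].
  by apply: elem_ext (elem_cst _ 1) => N _; rewrite big_nil.
have /(elem_ext _) := elem_mul (elem_coord setT (f i) (g (perm.fun_of_perm s i))) IH.
apply=> N _.
by rewrite big_cons mxE.
Qed.

(** * Bilinear forms and Gram-Schmidt *)

Section Bilinear.
Variables (R : realType) (n : nat).
Implicit Types (x y z : 'cV[R]_n) (B : 'M[R]_n).

Lemma dotE x y : dot x y = \sum_i x i ord0 * y i ord0.
Proof. by rewrite /dot mxE; apply: eq_bigr => i _; rewrite mxE. Qed.

Lemma dotC x y : dot x y = dot y x.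
Proof. by rewrite !dotE; apply: eq_bigr => i _; rewrite mulrC. Qed.

Lemma dotDr x y z : dot x (y + z) = dot x y + dot x z.
Proof. by rewrite /dot mulmxDr mxE. Qed.

Lemma dotZr c x y : dot x (c *: y) = c * dot x y.
Proof. by rewrite /dot -scalemxAr mxE. Qed.

Lemma dotDl x y z : dot (x + y) z = dot x z + dot y z.
Proof. by rewrite dotC dotDr !(dotC z). Qed.

Lemma dotZl c x y : dot (c *: x) y = c * dot x y.
Proof. by rewrite dotC dotZr dotC. Qed.

Lemma dot0r x : dot x 0 = 0.
Proof. by rewrite -[0 in LHS](scale0r 0) dotZr mul0r. Qed.

Lemma dotNr x y : dot x (- y) = - dot x y.
Proof. by rewrite -scaleN1r dotZr mulN1r. Qed.

Lemma dot_sumr x (I : Type) (r : seq I) (P : pred I) (f : I -> 'cV[R]_n) :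
  dot x (\sum_(i <- r | P i) f i) = \sum_(i <- r | P i) dot x (f i).
Proof. by apply: (big_morph _ (dotDr x) (dot0r x)). Qed.

Lemma dotNl x y : dot (- x) y = - dot x y.
Proof. by rewrite dotC dotNr dotC. Qed.

Lemma dot_ge0 x : 0 <= dot x x.
Proof. by rewrite dotE sumr_ge0 // => i _; rewrite -expr2 sqr_ge0. Qed.

Lemma dot_eq0 x : (dot x x == 0) = (x == 0).
Proof.
apply/eqP/eqP => [|->]; last exact: dot0r.
rewrite dotE => /psumr_eq0P x0; apply/matrixP => i j; rewrite ord1 mxE.
have /eqP := x0 (fun i _ => sqr_ge0 (x i ord0)) i isT.
by rewrite sqrf_eq0 => /eqP.
Qed.

Lemma dot_gt0 x : x != 0 -> 0 < dot x x.
Proof. by move=> x0; rewrite lt_neqAle eq_sym dot_eq0 x0 dot_ge0. Qed.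

Lemma dot_mulmxl B x y : dot (B *m x) y = dot x (B^T *m y).
Proof. by rewrite /dot trmx_mul mulmxA. Qed.

Definition bdot B x y := dot x (B *m y).

Lemma bdotDr B x y z : bdot B x (y + z) = bdot B x y + bdot B x z.
Proof. by rewrite /bdot mulmxDr dotDr. Qed.

Lemma bdotZr B c x y : bdot B x (c *: y) = c * bdot B x y.
Proof. by rewrite /bdot -scalemxAr dotZr. Qed.

Lemma bdotDl B x y z : bdot B (x + y) z = bdot B x z + bdot B y z.
Proof. exact: dotDl. Qed.

Lemma bdotZl B c x y : bdot B (c *: x) y = c * bdot B x y.
Proof. exact: dotZl. Qed.

Lemma bdotNr B x y : bdot B x (- y) = - bdot B x y.
Proof. by rewrite -scaleN1r bdotZr mulN1r. Qed.

Lemma bdotBr B x y z : bdot B x (y - z) = bdot B x y - bdot B x z.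
Proof. by rewrite bdotDr bdotNr. Qed.

Lemma bdot0r B x : bdot B x 0 = 0.
Proof. by rewrite /bdot mulmx0 dot0r. Qed.

Lemma bdot_sumr B x (I : Type) (r : seq I) (P : pred I) (f : I -> 'cV[R]_n) :
  bdot B x (\sum_(i <- r | P i) f i) = \sum_(i <- r | P i) bdot B x (f i).
Proof. by apply: (big_morph _ (bdotDr B x) (bdot0r B x)). Qed.

Lemma bdotC B x y : B^T = B -> bdot B x y = bdot B y x.
Proof. by move=> symB; rewrite /bdot dotC dot_mulmxl symB. Qed.

Lemma bdot_gt0 B x : symmetric_posdef B -> x != 0 -> 0 < bdot B x x.
Proof. by move=> [_]; apply. Qed.

Lemma bdot_col B m p (X : 'M[R]_(n, m)) (Y : 'M[R]_(n, p)) i j :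
  bdot B (col i X) (col j Y) = (X^T *m B *m Y) i j.
Proof.
by rewrite /bdot /dot tr_col (colE j) !mulmxA -!row_mul -colE !mxE.
Qed.

Lemma symmetric_posdef1 : symmetric_posdef (1%:M : 'M[R]_n).
Proof. by split=> [|x x0]; rewrite ?trmx1 // mul1mx dot_gt0. Qed.

Lemma posdef_unitmx B : symmetric_posdef B -> B \in unitmx.
Proof.
move=> [symB posB]; rewrite unitmxE unitfE; apply/det0P => -[v v0 vB].
have /posB : v^T != 0 by rewrite trmx_eq0.
by rewrite -symB -trmx_mul vB trmx0 dot0r ltxx.
Qed.

End Bilinear.

(** * Upper triangular matrices with positive diagonal *)

Section UpperTriangular.
Variables (R : realType) (n : nat).
Implicit Types S T : 'M[R]_n.

(** Two bases that differ by such a right factor span the same flag with the same orientations, and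
    so have the same Gram-Schmidt basis. *)
Definition uptri_pos T :=
  (forall i j : 'I_n, (j < i)%N -> T i j = 0) /\ forall i, 0 < T i i.

Lemma uptri_pos_mul S T : uptri_pos S -> uptri_pos T -> uptri_pos (S *m T).
Proof.
move=> [S0 Spos] [T0 Tpos]; split=> [i j ji|i]; rewrite mxE.
  apply: big1 => k _; have [ki|ik] := ltnP k i; first by rewrite S0 ?mul0r.
  by rewrite T0 ?mulr0 // (leq_trans ji ik).
rewrite (bigD1 i) //= big1 ?addr0 ?mulr_gt0 // => k ki.
have [lki|] := ltnP k i; first by rewrite S0 ?mul0r.
rewrite leq_eqVlt => /orP[/eqP ik|ik]; last by rewrite T0 ?mulr0.
by rewrite (val_inj ik) eqxx in ki.
Qed.

(** Strong induction on the column: below the diagonal, entry (i, j) of S T reduces to S i j * T j j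
    once the earlier columns of [S] are known to vanish there. *)
Lemma uptri_pos_inv S T : uptri_pos T -> S *m T = 1%:M -> uptri_pos S.
Proof.
move=> [T0 Tpos] ST.
have Sij (i j : 'I_n) : (j < i)%N -> S i j = 0.
  have [m] := ubnP (j : nat); elim: m j => // m IH j /ltnSE jm ji.
  have /matrixP/(_ i j) := ST; rewrite !mxE (bigD1 j) //= big1 => [|k kj].
    have -> : (i == j) = false by apply/eqP => ij; rewrite ij ltnn in ji.
    rewrite addr0 => /eqP; rewrite mulf_eq0 (gt_eqF (Tpos j)) orbF.
    by move/eqP.
  have [lkj|] := ltnP k j.
    by rewrite (IH k (leq_trans lkj jm) (ltn_trans lkj ji)) mul0r.
  rewrite leq_eqVlt => /orP[/eqP jk|jk]; last by rewrite T0 ?mulr0.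
  by rewrite (val_inj jk) eqxx in kj.
split=> // i; have /matrixP/(_ i i) := ST.
rewrite !mxE (bigD1 i) //= big1 => [|k ki].
  rewrite addr0 eqxx => SiTi; rewrite -(pmulr_lgt0 _ (Tpos i)).
  by rewrite SiTi ltr01.
have [lki|] := ltnP k i; first by rewrite Sij ?mul0r.
rewrite leq_eqVlt => /orP[/eqP ik|ik]; last by rewrite T0 ?mulr0.
by rewrite (val_inj ik) eqxx in ki.
Qed.

Lemma uptri_pos_scale c T : 0 < c -> uptri_pos T -> uptri_pos (c *: T).
Proof.
move=> c0 [T0 Tpos]; split=> [i j ji|i]; rewrite mxE; first by rewrite T0 ?mulr0.
by rewrite mulr_gt0.
Qed.

End UpperTriangular.

(** * Gram-Schmidt for a positive definite form *)

Section GramSchmidt.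
Variables (R : realType) (n : nat).
Implicit Types (B M Q : 'M[R]_n) (s : seq 'cV[R]_n).

(** The form is a parameter because two instances interact: [B = 1] gives [phi], and [B = A] gives
    the A-orthonormal basis of the same flag. *)
Definition gs_step B (qs : seq 'cV[R]_n) (v : 'cV[R]_n) :=
  let u := v - \sum_(q <- qs) bdot B q v *: q in
  rcons qs ((Num.sqrt (bdot B u u))^-1 *: u).

Definition gs B M : 'M[R]_n :=
  let qs := foldl (gs_step B) [::] [seq col j M | j <- enum 'I_n] in
  \matrix_(i, j) (nth 0 qs j) i ord0.

Lemma gram_schmidtE M : gram_schmidt M = gs 1%:M M.
Proof.
have dE : @dot R n = bdot 1%:M.
  by apply/funext => x; apply/funext => y; rewrite /bdot mul1mx.
rewrite /gs /gs_step -dE.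
by [].
Qed.

Lemma size_gs_foldl B s : size (foldl (gs_step B) [::] s) = size s.
Proof.
by elim/last_ind: s => // s v IH; rewrite foldl_rcons !size_rcons IH.
Qed.

Lemma nth_gs_foldl B s k : (k < size s)%N ->
  let qs := foldl (gs_step B) [::] s in
  let u := nth 0 s k - \sum_(0 <= j < k)
             bdot B (nth 0 qs j) (nth 0 s k) *: nth 0 qs j in
  nth 0 qs k = (Num.sqrt (bdot B u u))^-1 *: u.
Proof.
elim/last_ind: s => // s v IH; rewrite size_rcons ltnS foldl_rcons /gs_step /=.
set qs := foldl _ _ s => ks.
have szqs : size qs = size s by exact: size_gs_foldl.
rewrite !nth_rcons szqs; move: ks; rewrite leq_eqVlt => /orP[/eqP ->|ks].
  rewrite ltnn eqxx (big_nth 0) szqs.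
  under [in RHS]eq_big_nat => j /andP[_ js] do rewrite nth_rcons szqs js.
  by [].
rewrite ks IH //.
under [in RHS]eq_big_nat => j /andP[_ jk] do
  rewrite nth_rcons szqs (ltn_trans jk ks).
by [].
Qed.

Definition gs_residue B M k : 'cV[R]_n :=
  col k M - \sum_(j < n | (j < k)%N)
    bdot B (col j (gs B M)) (col k M) *: col j (gs B M).

Lemma col_gs B M k : col k (gs B M) =
  (Num.sqrt (bdot B (gs_residue B M k) (gs_residue B M k)))^-1 *:
    gs_residue B M k.
Proof.
set s := [seq col j M | j <- enum 'I_n].
have szs : size s = n by rewrite size_map size_enum_ord.
have colE (j : 'I_n) : col j (gs B M) = nth 0 (foldl (gs_step B) [::] s) j.
  by apply/matrixP => a b; rewrite ord1 !mxE.
have colM (j : 'I_n) : col j M = nth 0 s j.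
  by rewrite (nth_map j) ?size_enum_ord // nth_ord_enum.
have -> : gs_residue B M k = nth 0 s k - \sum_(0 <= j < k)
    bdot B (nth 0 (foldl (gs_step B) [::] s) j) (nth 0 s k) *:
      nth 0 (foldl (gs_step B) [::] s) j.
  rewrite /gs_residue colM; congr (_ - _).
  rewrite (big_ord_narrow (ltnW (ltn_ord k))) big_mkord.
  by apply: eq_bigr => j _; rewrite colE.
by rewrite colE; apply: nth_gs_foldl; rewrite szs.
Qed.

(** Uniqueness of the factorization M = Q T: by strong induction on the columns, the residue is T k
    k times column k of Q, and normalization removes this positive factor. *)
Lemma gs_unique B M Q :
  Q^T *m B *m Q = 1%:M -> uptri_pos (Q^T *m B *m M) -> gs B M = Q.
Proof.
move=> QBQ; move TE : (Q^T *m B *m M) => T [T0 Tpos].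
have ME : M = Q *m T by rewrite -TE mulmxA (mulmx1C QBQ) mul1mx.
suff colE (k : 'I_n) : col k (gs B M) = col k Q.
  by apply/matrixP => i j; have /matrixP/(_ i ord0) := colE j; rewrite !mxE.
have [m] := ubnP (k : nat); elim: m k => // m IH k /ltnSE km.
have uE : gs_residue B M k = T k k *: col k Q.
  rewrite /gs_residue; under eq_bigr => j jk.
    rewrite IH ?(leq_trans jk km) // bdot_col TE; over.
  rewrite ME colE -mulmxA -colE; apply/eqP; rewrite subr_eq; apply/eqP.
  apply/matrixP => i j; rewrite ord1 !mxE summxE (bigID (fun j : 'I_n => (j < k)%N)) /=.
  rewrite addrC; congr (_ + _); last first.
    by apply: eq_bigr => l _; rewrite !mxE mulrC.
  rewrite (bigD1 k) ?ltnn //= big1 ?addr0 => [|l /andP[]].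
    by rewrite !mxE mulrC.
  rewrite -leqNgt leq_eqVlt => /orP[/eqP kl|kl _]; last by rewrite !mxE T0 ?mulr0.
  by rewrite (val_inj kl) eqxx.
rewrite col_gs uE bdotZl bdotZr bdot_col QBQ mxE eqxx mulr1 -expr2.
rewrite sqrtr_sqr ger0_norm ?(ltW (Tpos k)) // scalerA mulVf ?scale1r //.
by rewrite gt_eqF.
Qed.

Section Posdef.
Variable B : 'M[R]_n.
Hypothesis posB : symmetric_posdef B.

(** The four facts need each other and go through one strong induction. The first one places column
    k in the span of the columns of [M] up to k, which is what keeps the next residues nonzero. *)
Lemma gs_step_spec M k : M \in unitmx ->
  [/\ exists2 x : 'cV[R]_n, col k (gs B M) = M *m x &
        forall i : 'I_n, (k < i)%N -> x i ord0 = 0,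
      gs_residue B M k != 0,
      bdot B (col k (gs B M)) (col k (gs B M)) = 1 &
      forall j : 'I_n, (j < k)%N -> bdot B (col j (gs B M)) (col k (gs B M)) = 0].
Proof.
move=> uM; have [m] := ubnP (k : nat); elim: m k => // m IH k /ltnSE km.
set q := fun j => col j (gs B M).
have xex (j : 'I_n) : exists y : 'cV[R]_n, (j < k)%N -> q j = M *m y /\
    forall i : 'I_n, (j < i)%N -> y i ord0 = 0.
  have [jk|kj] := ltnP j k; last by exists 0.
  by have [[y ? ?] _ _ _] := IH j (leq_trans jk km); exists y.
have [x xE] := choice xex.
(* Coordinates of the residue in the columns of [M]. Earlier columns do not contribute to coordinate
   k, which is therefore 1, so the residue is nonzero. *)
pose y : 'cV[R]_n := delta_mx k ord0 -
  \sum_(j < n | (j < k)%N) bdot B (q j) (col k M) *: x j.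
have uE : gs_residue B M k = M *m y.
  rewrite mulmxBr -colE mulmx_sumr; congr (_ - _); apply: eq_bigr => j jk.
  by rewrite -scalemxAr -(xE j jk).1.
have yk : y k ord0 = 1.
  rewrite !mxE !eqxx /= summxE big1 ?subr0 // => j jk.
  by rewrite mxE (xE j jk).2 ?mulr0.
have y0 (i : 'I_n) : (k < i)%N -> y i ord0 = 0.
  move=> ki; rewrite !mxE summxE big1 => [|j jk].
    by rewrite (_ : (i == k) = false) ?subr0 //; apply/eqP => ik; rewrite ik ltnn in ki.
  by rewrite mxE (xE j jk).2 ?mulr0 // (ltn_trans jk ki).
have u0 : gs_residue B M k != 0.
  apply/eqP => u0; have : y = 0 by rewrite -[y](mulKmx uM) -uE u0 mulmx0.
  by move/matrixP/(_ k ord0)/eqP; rewrite yk mxE oner_eq0.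
set u := gs_residue B M k in uE u0 *.
have uu := bdot_gt0 posB u0.
split=> //.
- exists ((Num.sqrt (bdot B u u))^-1 *: y).
    by rewrite col_gs -/u {3}uE scalemxAr.
  by move=> i ki; rewrite mxE y0 ?mulr0.
- rewrite col_gs -/u bdotZl bdotZr mulrA -invfM -expr2 sqr_sqrtr ?ltW //.
  by rewrite mulVf // gt_eqF.
- move=> j jk; rewrite [col k _]col_gs -/u bdotZr; apply/eqP; rewrite mulf_eq0.
  apply/orP; right; rewrite /u /gs_residue bdotBr bdot_sumr (bigD1 j) //= big1.
    have [_ _ qq _] := IH j (leq_trans jk km).
    by rewrite bdotZr qq mulr1 addr0 subrr.
  move=> l /andP[lk lj]; rewrite bdotZr; apply/eqP; rewrite mulf_eq0.
  apply/orP; right; apply/eqP; have [jl|] := ltnP j l.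
    by have [_ _ _] := IH l (leq_trans lk km); apply.
  rewrite leq_eqVlt => /orP[/eqP/val_inj ljE|ltlj]; first by rewrite ljE eqxx in lj.
  have [_ _ _ H] := IH j (leq_trans jk km).
  by rewrite bdotC ?H //; case: posB.
Qed.

Lemma gs_orthonormal M : M \in unitmx -> (gs B M)^T *m B *m gs B M = 1%:M.
Proof.
move=> uM; apply/matrixP => i j; rewrite -bdot_col mxE.
have [->|ij] := eqVneq i j; first by have [] := gs_step_spec j uM.
have [lij|] := ltnP i j; first by have [_ _ _ ->] := gs_step_spec j uM.
rewrite leq_eqVlt => /orP[/eqP/val_inj ji|ji]; first by rewrite ji eqxx in ij.
by rewrite bdotC; [have [_ _ _ ->] := gs_step_spec i uM|case: posB].
Qed.

Lemma gs_uptri M : M \in unitmx -> uptri_pos ((gs B M)^T *m B *m M).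
Proof.
move=> uM; have orth (i j : 'I_n) :
    bdot B (col i (gs B M)) (col j (gs B M)) = (i == j)%:R.
  by rewrite bdot_col gs_orthonormal // mxE.
have rE k : 0 < Num.sqrt (bdot B (gs_residue B M k) (gs_residue B M k)).
  by rewrite sqrtr_gt0 bdot_gt0 //; have [] := gs_step_spec k uM.
have ME k : col k M = Num.sqrt (bdot B (gs_residue B M k) (gs_residue B M k)) *:
    col k (gs B M) + \sum_(j < n | (j < k)%N)
    bdot B (col j (gs B M)) (col k M) *: col j (gs B M).
  by rewrite [in X in _ *: X]col_gs scalerA divff ?gt_eqF // scale1r subrK.
split=> [i j ji|i]; rewrite -bdot_col ME bdotDr bdotZr orth bdot_sumr.
  rewrite [_ == _](_ : _ = false); last by apply/eqP => ij; rewrite ij ltnn in ji.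
  rewrite mulr0 add0r big1 // => l lj; rewrite bdotZr orth.
  rewrite [_ == _](_ : _ = false) ?mulr0 //.
  by apply/eqP => il; rewrite -il in lj; have := ltn_trans lj ji; rewrite ltnn.
rewrite eqxx mulr1 big1 ?addr0 // => l li; rewrite bdotZr orth.
rewrite [_ == _](_ : _ = false) ?mulr0 //.
by apply/eqP => il; rewrite il ltnn in li.
Qed.

End Posdef.

End GramSchmidt.

(** For invertible arguments the residues do not vanish, so every square root and every inverse is
    taken of a positive quantity. *)
Lemma mx_elementary_gs (R : realType) (V : normedModType R) (U : set V) n
    (B : 'M[R]_n) (F : V -> 'M[R]_n) :
  symmetric_posdef B -> (forall x, U x -> F x \in unitmx) ->
  mx_elementary U F -> mx_elementary U (fun x => gs B (F x)).
Proof.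
move=> posB uF eF.
have eFcol k : mx_elementary U (fun x => col k (F x)).
  by move=> i j; apply: elem_ext (eF i k) => x _; rewrite mxE.
have eb (f g : V -> 'cV[R]_n) : mx_elementary U f -> mx_elementary U g ->
    elementary U (fun x => bdot B (f x) (g x)).
  move=> ef eg; apply: elem_dot => //; apply: mx_elementary_mul => //.
  exact: mx_elementary_cst.
suff H k : mx_elementary U (fun x => col k (gs B (F x))).
  by move=> i j; apply: elem_ext (H j i ord0) => x _; rewrite mxE.
have [m] := ubnP (k : nat); elim: m k => // m IH k /ltnSE km.
have eu : mx_elementary U (fun x => gs_residue B (F x) k).
  apply: mx_elementary_add => //; apply: mx_elementary_opp.
  apply: mx_elementary_sum => j jk; have ej := IH j (leq_trans jk km).
  by apply: mx_elementary_scale => //; exact: eb.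
have uu x : U x -> 0 < bdot B (gs_residue B (F x) k) (gs_residue B (F x) k).
  by move=> Ux; apply: bdot_gt0 => //; have [] := gs_step_spec posB k (uF x Ux).
have : mx_elementary U (fun x => (Num.sqrt (bdot B (gs_residue B (F x) k)
    (gs_residue B (F x) k)))^-1 *: gs_residue B (F x) k).
  apply: mx_elementary_scale => //; apply: elem_inv.
    by move=> x Ux; rewrite gt_eqF // sqrtr_gt0 uu.
  by apply: elem_sqrt => //; exact: eb.
by move=> eq i j; apply: elem_ext (eq i j) => x _; rewrite col_gs.
Qed.

(** * Convex hulls and barycentric coordinates *)

Section Convexity.
Variables (R : realType) (n : nat).
Implicit Types (x y : 'cV[R]_n) (X : set 'cV[R]_n).

Lemma convex_setE X : @convex_set R 'cV[R]_n X <->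
  forall x y (t : R), X x -> X y -> 0 <= t -> t <= 1 ->
    X (t *: x + (1 - t) *: y).
Proof.
split=> [cX x y t Xx Xy t0 t1|cX x y l].
  by have := cX x y (Itv01 t0 t1); rewrite !inE; apply.
by rewrite !inE => Xx Xy; apply: cX.
Qed.

(** Dividing by the total weight makes induction on the list possible: a new point joins the
    barycenter of the others by one binary combination. *)
Lemma convex_set_sum X (I : Type) (r : seq I) (c : I -> R) (v : I -> 'cV[R]_n) :
  @convex_set R 'cV[R]_n X -> (forall i, 0 <= c i) -> (forall i, X (v i)) ->
  0 < \sum_(i <- r) c i ->
  X ((\sum_(i <- r) c i)^-1 *: \sum_(i <- r) c i *: v i).
Proof.
move=> /convex_setE cX c0 Xv; elim: r => [|i r IH]; rewrite ?big_nil ?ltxx //.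
rewrite !big_cons => sr0; have rs0 : 0 <= \sum_(j <- r) c j by exact: sumr_ge0.
(* If the others weigh 0 they have no barycenter, but then all their weights vanish. *)
have [s0|s0] := eqVneq (\sum_(j <- r) c j) 0.
  rewrite s0 addr0 in sr0 *; have -> : \sum_(j <- r) c j *: v j = 0.
    elim: r {IH rs0} s0 => [|j r IH]; rewrite ?big_nil // !big_cons => /eqP.
    rewrite paddr_eq0 ?sumr_ge0 // => /andP[/eqP -> /eqP/IH ->].
    by rewrite scale0r addr0.
  by rewrite addr0 scalerA mulVf ?scale1r // gt_eqF.
set s := \sum_(j <- r) c j in rs0 s0 sr0 *.
have s_gt0 : 0 < s by rewrite lt_neqAle eq_sym s0.
have := cX (v i) _ (c i / (c i + s)) (Xv i) (IH s_gt0).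
rewrite ler_pdivrMr // mul1r lerDl rs0 divr_ge0 ?(ltW sr0) // => /(_ isT isT).
congr X; rewrite scalerDr !scalerA; congr (_ *: _ + _ *: _).
  by rewrite mulrC.
by rewrite -/s; field; rewrite s0 gt_eqF.
Qed.

Lemma convex_hullS X Y : X `<=` convex_hull Y ->
  convex_hull X `<=` convex_hull Y.
Proof.
move=> XY; apply: smallest_sub => //; apply/convex_setE.
move=> x y t Yx Yy t0 t1 C [cC YC]; move/convex_setE: (cC); apply=> //.
  exact: Yx.
exact: Yy.
Qed.

Lemma hull_of_columnsE (V : 'M[R]_(n, n.+1)) : hull_of_columns V =
  [set x | exists c : 'cV[R]_n.+1,
     [/\ forall i, 0 <= c i ord0, \sum_i c i ord0 = 1 & x = V *m c]].
Proof.
apply/seteqP; split; last first.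
  move=> _ /= [c [c0 c1 ->]] C [cC VC].
  have := @convex_set_sum C _ (index_enum _) (fun i => c i ord0)
    (fun i => col i V) cC c0 (fun i => VC _ (ex_intro2 _ _ i I erefl)).
  rewrite c1 ltr01 invr1 scale1r => /(_ isT).
  suff -> : V *m c = \sum_i c i ord0 *: col i V by [].
  apply/matrixP => i j.
  by rewrite ord1 summxE mxE; apply: eq_bigr => k _; rewrite !mxE mulrC.
apply: smallest_sub => [|_ [j _ <-]]; last first.
  exists (delta_mx j ord0); split=> [i||]; last by rewrite -colE.
    by rewrite mxE ler0n.
  rewrite (bigD1 j) //= big1 => [|i ij]; rewrite !mxE ?eqxx ?addr0 //.
  by rewrite (negPf ij).
apply/convex_setE => _ _ t [c [c0 c1 ->]] [d [d0 d1 ->]] t0 t1.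
exists (t *: c + (1 - t) *: d); split=> [i||].
- by rewrite !mxE addr_ge0 // mulr_ge0 // subr_ge0.
- under eq_bigr do rewrite !mxE.
  by rewrite big_split /= -!mulr_sumr c1 d1 !mulr1 addrC subrK.
- by rewrite mulmxDr !scalemxAr.
Qed.

End Convexity.

Section Barycentric.
Variables (R : realType) (n : nat).
Implicit Types (V : 'M[R]_(n, n.+1)) (W : 'M[R]_(n.+1, n)) (l : 'cV[R]_n.+1).

(* The point x has barycentric coordinates l + W x with respect to the columns
   of V. *)
Definition barycentric V W l :=
  [/\ V *m W = 1%:M, V *m l = 0, W *m V + l *m const_mx 1 = 1%:M,
      const_mx 1 *m W = 0 :> 'rV[R]_n & \sum_i l i ord0 = 1].

Definition coord_vec W i : 'cV[R]_n := (row i W)^T.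

Lemma coord_vecE W i (x : 'cV[R]_n) : (W *m x) i ord0 = dot (coord_vec W i) x.
Proof. by rewrite /dot /coord_vec trmxK -row_mul [RHS]mxE. Qed.

(** The hypothesis says that the block row (l W) is a left inverse of the square matrix with block
    rows 1 and V. It is then a right inverse too, and the four blocks of that product are the other
    equations. *)
Lemma left_inverse_barycentric V W l :
  W *m V + l *m const_mx 1 = 1%:M -> barycentric V W l.
Proof.
move=> WV; have : row_mx l W *m col_mx (const_mx 1 : 'rV_n.+1) V = 1%:M.
  by rewrite mul_row_col addrC.
move=> /mulmx1C inv.
have : col_mx (const_mx 1) V *m row_mx l W = 1%:M :> 'M[R]_(1 + n) by [].
rewrite mul_col_row scalar_mx_block => /eq_block_mx[el eW Vl VW]; split=> //.
have /matrixP/(_ ord0 ord0) := el; rewrite !mxE eqxx => lE; apply: etrans lE.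
by apply: eq_bigr => i _; rewrite [X in _ = X * _]mxE mul1r.
Qed.

Lemma unitmx_barycentric V :
  col_mx (const_mx 1 : 'rV_n.+1) V \in unitmx -> exists W l, barycentric V W l.
Proof.
move=> uM; set M := col_mx _ V in uM; pose N : 'M[R]_(n.+1, 1 + n) := invmx M.
exists (rsubmx N), (lsubmx N); apply: left_inverse_barycentric.
by have := mulVmx uM; rewrite -/N -{1}(hsubmxK N) mul_row_col addrC.
Qed.

Section Given.
Variables (V : 'M[R]_(n, n.+1)) (W : 'M[R]_(n.+1, n)) (l : 'cV[R]_n.+1).
Hypothesis bary : barycentric V W l.

Lemma barycentric_combination (c : 'cV[R]_n.+1) : \sum_i c i ord0 = 1 ->
  l + W *m (V *m c) = c.
Proof.
move=> c1; have [_ _ WV _ _] := bary.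
have c1' : const_mx 1 *m c = 1%:M :> 'M[R]_1.
  apply/matrixP => i j; rewrite !ord1 !mxE eqxx; apply: etrans c1.
  by apply: eq_bigr => k _; rewrite mxE mul1r.
rewrite mulmxA addrC -[X in _ + X]mulmx1 -c1' (mulmxA l) -mulmxDl WV mul1mx.
by [].
Qed.

Lemma barycentric_point (x : 'cV[R]_n) : V *m (l + W *m x) = x.
Proof.
by have [VW Vl _ _ _] := bary; rewrite mulmxDr Vl add0r mulmxA VW mul1mx.
Qed.

Lemma barycentric_sum (x : 'cV[R]_n) : \sum_i (l + W *m x) i ord0 = 1.
Proof.
have [_ _ _ eW l1] := bary.
under eq_bigr do rewrite mxE.
rewrite big_split /= l1.
have /matrixP/(_ ord0 ord0) : const_mx 1 *m (W *m x) = 0 :> 'M[R]_1.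
  by rewrite mulmxA eW mul0mx.
rewrite mxE [RHS]mxE (eq_bigr (fun i => (W *m x) i ord0)) => [->|i _].
  by rewrite addr0.
by rewrite [X in X * _]mxE mul1r.
Qed.

Lemma barycentric_col j i : (l + W *m col j V) i ord0 = (i == j)%:R.
Proof.
have [_ _ WV _ _] := bary; have /matrixP/(_ i j) := WV.
by rewrite !mxE big_ord1 mxE mulr1 addrC => <-; congr (_ + _);
  apply: eq_bigr => k _; rewrite mxE.
Qed.

Lemma hull_barycentric : hull_of_columns V =
  [set x | forall i, 0 <= (l + W *m x) i ord0].
Proof.
rewrite hull_of_columnsE; apply/seteqP; split=> x /=.
  by move=> [c [c0 c1 ->]] i; rewrite barycentric_combination.
move=> x0; exists (l + W *m x); split=> //; first exact: barycentric_sum.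
by rewrite barycentric_point.
Qed.

Lemma hull_col j : hull_of_columns V (col j V).
Proof. by rewrite hull_barycentric => i; rewrite barycentric_col ler0n. Qed.

Lemma col_inj : injective (fun j => col j V).
Proof.
move=> i j /= ij; apply/eqP/negPn/negP => nij.
have := barycentric_col i i; rewrite ij barycentric_col (negPf nij) eqxx.
by move/eqP; rewrite eq_sym oner_eq0.
Qed.

(** A column is extreme because all its barycentric coordinates but one are 0, the least possible
    value. Conversely, a point with two nonzero coordinates i, j can be moved both ways along v_i -
    v_j. *)
Lemma vertices_hull : vertices (hull_of_columns V) = range (fun j => col j V).
Proof.
apply/seteqP; split=> [x [Px xext]|_ [j _ <-]]; last first.
  split=> [|y z t]; first exact: hull_col.
  rewrite hull_barycentric => /= y0 z0 /andP[t0 t1] jE.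
  have yz i : t * (l + W *m y) i ord0 + (1 - t) * (l + W *m z) i ord0 = (i == j)%:R.
    rewrite -barycentric_col jE mulmxDr -!scalemxAr !mxE.
    by rewrite /=; ring.
  have vert w : (forall i, 0 <= (l + W *m w) i ord0) ->
      (forall i, i != j -> (l + W *m w) i ord0 = 0) -> w = col j V.
    move=> w0 wj; rewrite -[w]barycentric_point colE; congr (_ *m _).
    apply/matrixP => i k; rewrite ord1 [RHS]mxE eqxx andbT.
    have [->|/wj //] := eqVneq i j.
    by have := barycentric_sum w; rewrite (bigD1 j) //= big1 ?addr0.
  have t10 : 0 < 1 - t by rewrite subr_gt0.
  have both i : i != j -> (l + W *m y) i ord0 = 0 /\ (l + W *m z) i ord0 = 0.
    move=> ij; have /eqP := yz i; rewrite (negPf ij).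
    rewrite paddr_eq0 ?mulr_ge0 ?(ltW t0) ?(ltW t10) // !mulf_eq0.
    by rewrite (gt_eqF t0) (gt_eqF t10) /= => /andP[/eqP -> /eqP ->].
  by transitivity (col j V); [|symmetry]; apply: vert => // i /both[].
have := Px; rewrite {1}hull_barycentric => /= x0.
have [j xj0] : exists j, (l + W *m x) j ord0 != 0.
  apply/existsP; apply/negbNE/negP; rewrite negb_exists => /forallP x00.
  have := barycentric_sum x; rewrite big1 => [/eqP|i _].
    by rewrite eq_sym oner_eq0.
  by have := x00 i; rewrite negbK => /eqP.
exists j => //; rewrite -[RHS]barycentric_point colE; congr (_ *m _).
have other i : i != j -> (l + W *m x) i ord0 = 0.
  move=> ij; apply/eqP/negPn/negP => xi0.
  (* The smaller of the two coordinates is the longest move that keeps both nonnegative in either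
     direction. *)
  set e := Num.min ((l + W *m x) i ord0) ((l + W *m x) j ord0).
  have e0 : 0 < e by rewrite lt_min !lt_neqAle eq_sym xi0 eq_sym xj0 !x0.
  set d := e *: (col i V - col j V).
  have dE k : (W *m d) k ord0 = e * ((k == i)%:R - (k == j)%:R).
    rewrite /d -scalemxAr mulmxBr mxE -!barycentric_col; congr (_ * _).
    by rewrite !mxE; ring.
  have eij : e <= (l + W *m x) i ord0 /\ e <= (l + W *m x) j ord0.
    by rewrite !ge_min !lexx orbT.
  have Pd : hull_of_columns V (x + d) /\ hull_of_columns V (x - d).
    rewrite hull_barycentric; split=> k.
      rewrite mulmxDr addrA mxE dE.
      have [->|ki] := eqVneq k i.
        by rewrite (negPf ij) subr0 mulr1 addr_ge0 // ltW.
      have [->|kj] := eqVneq k j; last by rewrite subrr mulr0 addr0.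
      by rewrite sub0r mulrN1 subr_ge0; case: eij.
    rewrite mulmxBr addrA mxE [X in _ + X]mxE dE.
    have [->|ki] := eqVneq k i.
      by rewrite (negPf ij) subr0 mulr1 subr_ge0; case: eij.
    have [->|kj] := eqVneq k j; last by rewrite subrr mulr0 subr0.
    by rewrite sub0r mulrN1 opprK addr_ge0 // ltW.
  have half : x = 2^-1 *: (x + d) + (1 - 2^-1) *: (x - d).
    by apply/matrixP => a b; rewrite !mxE; lra.
  have h01 : 0 < (2^-1 : R) < 1 by lra.
  have := xext _ _ _ Pd.1 Pd.2 h01 half.
  move=> /(congr1 (fun u => (W *m u) i ord0)).
  rewrite mulmxDr mulmxBr mxE [RHS]mxE [X in _ = _ + X]mxE !dE eqxx (negPf ij).
  rewrite /= subr0 mulr1; move: e0; clear; move: e => e; lra.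
apply/matrixP => i k; rewrite ord1 [LHS]mxE eqxx andbT.
have [->|/other //] := eqVneq i j.
by have := barycentric_sum x; rewrite (bigD1 j) //= big1 ?addr0.
Qed.

(** [l] holds the barycentric coordinates of the origin; when they are positive, continuity makes
    the origin an interior point. *)
Lemma barycentric_labeled : (forall i, 0 < l i ord0) -> labeled_simplex V.
Proof.
move=> l0; split.
  by rewrite vertices_hull; split=> [j _|i j _ _|_ [j _ <-]];
    [exists j|exact: col_inj|exists j].
exists 0; rewrite /interior hull_barycentric /=.
suff : \forall x \near (0 : 'cV[R]_n), forall i, 0 <= (l + W *m x) i ord0 by [].
apply: (filter_forall (nbhs_filter (0 : 'cV[R]_n))) => i.
have : (fun x : 'cV[R]_n => (l + W *m x) i ord0) @ (0 : 'cV[R]_n) -->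
    (l + W *m 0) i ord0.
  apply: differentiable_continuous.
  suff /(elementary_derive openT) [dd _] : elementary setT
    (fun x : 'cV[R]_n => (l + W *m x) i ord0) by exact: dd.
  have : mx_elementary setT (fun x : 'cV[R]_n => l + W *m x).
    apply: mx_elementary_add; first exact: mx_elementary_cst.
    by apply: mx_elementary_mul; [exact: mx_elementary_cst|exact: mx_elementary_id].
  exact.
move=> /cvgr_ge; apply; rewrite mulmx0 addr0; exact: l0.
Qed.

End Given.

(** If the matrix with rows 1 and V were singular, the whole hull would satisfy an affine equation c
    + u x = 0. Moving from an interior point along u forces u = 0, and then c = 0. *)
Lemma labeled_barycentric V : labeled_simplex V -> exists W l, barycentric V W l.
Proof.
move=> [_ [x0 intx]]; apply: unitmx_barycentric.
rewrite unitmxE unitfE; apply/det0P => -[v v0].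
rewrite -[v]hsubmxK mul_row_col; set c := lsubmx v; set u := rsubmx v => cuV.
have hull0 x : hull_of_columns V x -> c + u *m x = 0.
  rewrite hull_of_columnsE => -[d [_ d1 ->]].
  have d1' : const_mx 1 *m d = 1%:M :> 'M[R]_1.
    apply/matrixP => i j; rewrite !ord1 !mxE eqxx -[RHS]d1.
    by apply: eq_bigr => k _; rewrite mxE mul1r.
  by rewrite mulmxA -[X in X + _]mulmx1 -d1' (mulmxA c) -mulmxDl cuV mul0mx.
have cvgx : (fun t : R => x0 + t *: u^T) @ (0 : R) --> x0.
  rewrite -[X in _ --> X]addr0 -(scale0r u^T); apply: cvgD; first exact: cvg_cst.
  by apply: cvgZr_tmp; exact: cvg_id.
have /nbhs_ballP[e /= e0 eP] := cvgx _ intx.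
have /hull0 : hull_of_columns V (x0 + (e / 2) *: u^T).
  by apply: (eP (e / 2)); rewrite /ball /= sub0r normrN gtr0_norm ?divr_gt0 //; lra.
rewrite mulmxDr addrA (hull0 x0) ?add0r; last exact: interior_subset.
rewrite -scalemxAr => /matrixP/(_ ord0 ord0)/eqP; rewrite !mxE mulf_eq0.
rewrite gt_eqF ?divr_gt0 //= => uu.
have u0 : u = 0.
  apply/trmx_inj/eqP; rewrite trmx0 -dot_eq0 dotE -[X in _ == X](eqP uu).
  by apply/eqP; apply: eq_bigr => i _; rewrite !mxE.
have c0 : c = 0.
  by have := hull0 _ (interior_subset intx); rewrite u0 mul0mx addr0.
by move: v0; rewrite -[v]hsubmxK -/c -/u c0 u0 row_mx0 eqxx.
Qed.

End Barycentric.

(** * Simplices around the sphere *)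

(** The curve is the rational parametrization of the circle through [p] with velocity [v]: the
    choice a = |v|^2 / 4 gives f^2 + |v|^2 g^2 = 1. *)
Lemma sphere_tangent_vector (R : realType) (n : nat) (p v : 'cV[R]_n) :
  dot p p = 1 -> dot p v = 0 -> tangent_vector (@unit_sphere R n) p v.
Proof.
move=> pp pv; set a := dot v v / 4.
have a0 : 0 <= a by rewrite divr_ge0 ?dot_ge0.
have den t : 1 + a * t ^+ 2 != 0.
  by rewrite gt_eqF // ltr_wpDr // mulr_ge0 // sqr_ge0.
pose f (t : R) := (1 - a * t ^+ 2) * (1 + a * t ^+ 2)^-1.
pose g (t : R) := t * (1 + a * t ^+ 2)^-1.
exists (fun t => f t *: p + g t *: v); split.
- move=> t; rewrite /unit_sphere /= dotDl !dotDr !dotZl !dotZr (dotC v p) pp pv.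
  have -> : dot v v = 4 * a by rewrite /a; field.
  by rewrite /f /g; field; exact: den.
- by rewrite /f /g expr0n /= mulr0 subr0 addr0 invr1 mulr1 mul0r scale1r scale0r addr0.
have entry i j : is_derive (0 : R) 1 (fun t => (f t *: p + g t *: v) i j) (v i j).
  have -> : (fun t => (f t *: p + g t *: v) i j) =
      (fun t => f t * p i j + g t * v i j).
    by apply/funext => t; rewrite !mxE.
  have dden : is_derive (0 : R) 1 (fun t : R => (1 + a * t ^+ 2)^-1) 0.
    have d : is_derive (0 : R) 1 (fun t : R => 1 + a * t ^+ 2) 0.
      by apply: is_derive_eq; rewrite /GRing.scale /=; ring.
    have := is_deriveV (f := fun t : R => 1 + a * t ^+ 2) (den 0) d.
    by rewrite scaler0.
  have df : is_derive (0 : R) 1 f 0.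
    apply: is_derive_eq; rewrite /GRing.scale /=; ring.
  have dg : is_derive (0 : R) 1 g 1.
    by apply: is_derive_eq; rewrite /GRing.scale /=; field.
  have h := is_deriveD (is_deriveM df (is_derive_cst (p i j) (0 : R) 1))
    (is_deriveM dg (is_derive_cst (v i j) (0 : R) 1)).
  by apply: (is_derive_eq h); rewrite /GRing.scale /=; ring.
have dgam : derivable (fun t => f t *: p + g t *: v) (0 : R) 1.
  by apply/derivable_mxP => i j; have [] := entry i j.
split=> //; rewrite derive_mx //; apply/matrixP => i j; rewrite mxE.
by have [_ ->] := entry i j.
Qed.

Section Insphere.
Variables (R : realType) (n : nat).
Variables (V : 'M[R]_(n, n.+1)) (W : 'M[R]_(n.+1, n)) (l : 'cV[R]_n.+1).
Hypothesis bary : barycentric V W l.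
Let w i := coord_vec W i.

Lemma barycentricE x i : (l + W *m x) i ord0 = l i ord0 + dot (w i) x.
Proof. by rewrite mxE coord_vecE. Qed.

(** Expanding |w_i + l_i x|^2 >= 0 on the sphere gives l_i (l_i + <w_i, x>) >= 0, a Cauchy-Schwarz
    bound free of square roots. *)
Lemma sphere_sub_hull :
  (forall i, 0 < l i ord0) -> (forall i, dot (w i) (w i) <= l i ord0 ^+ 2) ->
  @unit_sphere R n `<=` hull_of_columns V.
Proof.
move=> l0 wl x; rewrite (hull_barycentric bary) /unit_sphere /= => xx i.
rewrite barycentricE.
have := dot_ge0 (w i + l i ord0 *: x); rewrite dotDl !dotDr !dotZl !dotZr xx.
rewrite (dotC x) => h; rewrite -(pmulr_rge0 _ (l0 i)).
have := wl i; nra.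
Qed.

Hypothesis n0 : (0 < n)%N.

(** Otherwise coordinate i would be constant, although it is 1 at v_i and 0 at another vertex, which
    exists as n > 0. *)
Lemma coord_vec_neq0 i : w i != 0.
Proof.
apply/eqP => wi0.
have li j : l i ord0 = (i == j)%:R.
  by rewrite -(barycentric_col bary) barycentricE wi0 dotC dot0r addr0.
have [j ji] : exists j, j != i.
  exists (lift i (Ordinal n0)); rewrite eq_sym; exact: neq_lift.
have := li i; rewrite eqxx (li j) eq_sym (negPf ji) => /eqP.
by rewrite eq_sym oner_eq0.
Qed.

Lemma sphere_hull_coord : @unit_sphere R n `<=` hull_of_columns V ->
  forall i, 0 < l i ord0 /\ dot (w i) (w i) <= l i ord0 ^+ 2.
Proof.
move=> SP i; have ww := dot_gt0 (coord_vec_neq0 i).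
set s := Num.sqrt (dot (w i) (w i)).
have s0 : 0 < s by rewrite sqrtr_gt0.
have ss : s ^+ 2 = dot (w i) (w i) by rewrite sqr_sqrtr // ltW.
(* On the sphere, coordinate i is smallest at - w_i / |w_i|, with value l_i - |w_i|. *)
have : @unit_sphere R n (- s^-1 *: w i).
  by rewrite /unit_sphere /= dotZl dotZr -ss; field; rewrite gt_eqF.
move=> /SP; rewrite (hull_barycentric bary) => /(_ i).
rewrite barycentricE dotZr -ss.
have -> : - s^-1 * s ^+ 2 = - s by field; rewrite gt_eqF.
move=> sl; split; nra.
Qed.

(** Insert V W = 1 after [A] and rotate cyclically under the trace. *)
Lemma trace_barycentric (A : 'M[R]_n) :
  \tr A = \sum_i dot (w i) (A *m col i V).
Proof.
have [VW _ _ _ _] := bary.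
rewrite -[A in LHS]mulmx1 -VW mulmxA mxtrace_mulC mulmxA /mxtrace.
apply: eq_bigr => i _; rewrite -coord_vecE colE !mulmxA -colE.
by rewrite [RHS]mxE.
Qed.

(* Expand |x - c y|^2 >= 0. *)
Lemma dot_le_weight (x y : 'cV[R]_n) (c : R) : 0 < c -> dot x x <= c ^+ 2 ->
  dot y y <= 1 -> dot x y <= c ?= iff (x == c *: y) && (dot y y == 1).
Proof.
move=> c0 xx yy; have := dot_ge0 (x - c *: y).
have dE : dot (x - c *: y) (x - c *: y) =
    dot x x - 2 * c * dot x y + c ^+ 2 * dot y y.
  by rewrite dotDl !dotDr !dotNl !dotNr !dotZl !dotZr (dotC y x); ring.
rewrite dE => h; have xyc : dot x y <= c by rewrite -(ler_pM2l c0); nra.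
split=> //; apply/idP/idP => [/eqP xyE|/andP[/eqP -> /eqP y1]]; last first.
  by rewrite dotZl y1 mulr1.
have xc : dot (x - c *: y) (x - c *: y) = 0.
  by apply/eqP; rewrite eq_le dot_ge0 andbT dE xyE; nra.
move/eqP: (xc); rewrite dot_eq0 subr_eq0 => /eqP xE; rewrite -xE eqxx /=.
move: xyE; rewrite xE dotZl => /eqP; rewrite -[X in _ == X]mulr1.
by rewrite (inj_eq (mulfI _)) // gt_eqF.
Qed.

Lemma trace_le1 (A : 'M[R]_n) :
  (forall i, 0 < l i ord0 /\ dot (w i) (w i) <= l i ord0 ^+ 2) ->
  (forall i, dot (A *m col i V) (A *m col i V) <= 1) ->
  \tr A <= 1 ?= iff [forall i, (w i == l i ord0 *: (A *m col i V)) &&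
     (dot (A *m col i V) (A *m col i V) == 1)].
Proof.
move=> wl Av; have [_ _ _ _ l1] := bary.
suff : \sum_i dot (w i) (A *m col i V) <= \sum_i l i ord0 ?= iff
    [forall i, (w i == l i ord0 *: (A *m col i V)) &&
     (dot (A *m col i V) (A *m col i V) == 1)].
  by rewrite l1 -trace_barycentric.
by apply: leif_sum => i _; have [? ?] := wl i; exact: dot_le_weight.
Qed.

(** The supporting function c - <u, x> of a facet is the combination of its values g_j >= 0 at the
    vertices with the barycentric coordinates as weights. Exactly one g_i is positive, so F is the
    face where coordinate i vanishes, and this face touches the sphere at - w_i / l_i. *)
Lemma circumscribed_sphere :
  (forall i, 0 < l i ord0) -> (forall i, dot (w i) (w i) = l i ord0 ^+ 2) ->
  circumscribed (@unit_sphere R n) (hull_of_columns V).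
Proof.
move=> l0 wl F [u [c [u0 uP FE [X [affX FX]]]]].
have [VW Vl WV eW l1] := bary.
set P := hull_of_columns V in uP FE *.
pose lam x : 'cV[R]_n.+1 := l + W *m x.
pose g j := c - dot u (col j V).
have g0 j : 0 <= g j by rewrite subr_ge0; apply: uP; exact: hull_col bary j.
have gE x : c - dot u x = \sum_j lam x j ord0 * g j.
  rewrite -{1}(barycentric_point bary x) -/(lam x).
  under eq_bigr do rewrite mulrBr.
  rewrite sumrB -mulr_suml (barycentric_sum bary) mul1r; congr (_ - _).
  rewrite (_ : V *m lam x = \sum_j lam x j ord0 *: col j V); last first.
    apply/matrixP => i j; rewrite ord1 summxE mxE.
    by apply: eq_bigr => k _; rewrite !mxE mulrC.
  by rewrite dot_sumr; apply: eq_bigr => j _; rewrite dotZr.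
have lamF x j : F x -> 0 < g j -> lam x j ord0 = 0.
  rewrite FE => -[Px /eqP]; rewrite eq_sym -subr_eq0 gE.
  have /= Px' : [set x | forall i, 0 <= (l + W *m x) i ord0] x.
    by rewrite -(hull_barycentric bary).
  rewrite psumr_eq0 => [/allP/(_ j)|k _]; last by rewrite mulr_ge0.
  by rewrite mem_index_enum mulf_eq0 => /(_ isT)/orP[/eqP //|/eqP ->]; rewrite ltxx.
(* If all g_j vanished, u would be constant on the vertices, and u^T = u^T V W would be a multiple
   of the row 1 W = 0. *)
have [i gi] : exists i, 0 < g i.
  apply/existsP; apply/negbNE/negP; rewrite negb_exists => /forallP gn.
  move/negP: u0; apply; rewrite -trmx_eq0 -[u^T]mulmx1 -VW mulmxA.
  suff -> : u^T *m V = c *: const_mx 1 by rewrite -scalemxAl eW scaler0.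
  apply/matrixP => a j; rewrite ord1 [RHS]mxE [X in _ * X]mxE mulr1.
  have : g j = 0 by apply/eqP; rewrite eq_le g0 leNgt gn.
  move/eqP; rewrite subr_eq0 => /eqP ->.
  by rewrite /dot colE mulmxA -colE [RHS]mxE.
(* If coordinates i and k both vanish on F, the coordinate matrix [L] of the n points of F has two
   zero rows. Without row i it is square and still has a zero row, so [L] kills a nonzero vector,
   which is an affine dependence between the points. *)
have gother k : k != i -> g k = 0.
  move=> ki; apply/eqP; rewrite eq_le g0 leNgt andbT; apply/negP => gk.
  pose L : 'M[R]_(n.+1, n) := l *m const_mx 1 + W *m X.
  have LE a b : L a b = lam (col b X) a ord0.
    rewrite /L /lam colE mulmxA -colE !mxE big_ord1 mxE mulr1.
    by congr (_ + _).
  have Li b : L i b = 0 by rewrite LE lamF.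
  have [k' kE|kE] := unliftP i k; last by rewrite kE eqxx in ki.
  have detL : \det (row' i L) = 0.
    apply/eqP/det0P; exists (delta_mx ord0 k').
      apply/eqP => /matrixP/(_ ord0 k')/eqP.
      by rewrite !mxE !eqxx oner_eq0.
    rewrite -rowE; apply/matrixP => a b; rewrite 2![LHS]mxE [RHS]mxE -kE LE.
    exact: lamF.
  have : \det (row' i L)^T == 0 by rewrite det_tr detL.
  case/det0P => y y0 yL; move/negP: y0; apply.
  rewrite -trmx_eq0; apply/eqP.
  have Ly : L *m y^T = 0.
    apply/matrixP => a b; rewrite ord1 [RHS]mxE.
    have [a' ->|->] := unliftP i a; last first.
      by rewrite mxE big1 // => d _; rewrite Li mul0r.
    have /matrixP/(_ ord0 a') := yL; rewrite mxE [RHS]mxE mxE => E.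
    apply: etrans E; apply: eq_bigr => d _.
    by rewrite mulrC [y^T _ _]mxE; congr (_ * _); rewrite 2![RHS]mxE.
  have e1 : const_mx 1 *m l = 1%:M :> 'M[R]_1.
    apply/matrixP => a b; rewrite !ord1 !mxE eqxx; apply: etrans l1.
    by apply: eq_bigr => d _; rewrite mxE mul1r.
  apply: affX.
    have : const_mx 1 *m (L *m y^T) = 0 :> 'M[R]_1 by rewrite Ly mulmx0.
    rewrite mulmxA mulmxDr !mulmxA e1 eW mul0mx addr0 mul1mx.
    move=> /matrixP/(_ ord0 ord0); rewrite mxE [RHS]mxE => E; apply: etrans E.
    by apply: eq_bigr => d _; rewrite [X in _ = X * _]mxE mul1r.
  have : V *m (L *m y^T) = 0 by rewrite Ly mulmx0.
  by rewrite mulmxA mulmxDr !mulmxA Vl VW mul0mx add0r mul1mx.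
set li := l i ord0; have li0 : li != 0 by rewrite gt_eqF ?l0.
(* Foot of the perpendicular from the origin to the hyperplane l_i + <w_i, x> = 0; it is a unit
   vector because |w_i| = l_i. *)
set p := - li^-1 *: w i.
have Sp : @unit_sphere R n p.
  by rewrite /unit_sphere /= dotZl dotZr wl -/li; field.
have lamip : lam p i ord0 = 0.
  by rewrite barycentricE /p dotZr wl -/li; field.
have FxE x : P x -> lam x i ord0 = 0 -> F x.
  move=> Px lx; rewrite FE; split=> //; apply/eqP.
  rewrite eq_sym -subr_eq0 gE (bigD1 i) //= lx mul0r add0r big1 // => j ji.
  by rewrite gother ?mulr0.
exists p; split=> //.
  apply: FxE => //; apply: sphere_sub_hull => // j.
  by rewrite wl.
move=> x Fx; apply: sphere_tangent_vector => //.
have := lamF x i Fx gi; rewrite barycentricE -/li => lx.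
rewrite dotDr dotNr Sp {1}/p dotZl.
have -> : dot (w i) x = - li by apply/eqP; rewrite -addr_eq0 addrC lx.
by field.
Qed.

End Insphere.

(** * Membership in the ellipsoid and in its convex hull *)

Section Ellipsoid.
Variables (R : realType) (n : nat) (A : 'M[R]_n) (E : set 'cV[R]_n).
Hypothesis uA : A \in unitmx.
Hypothesis AE : [set A *m x | x in E] = @unit_sphere R n.

Lemma ellipsoidE x : E x <-> dot (A *m x) (A *m x) = 1.
Proof.
split=> [Ex|Ax]; first by rewrite -[_ = _]/(@unit_sphere R n _) -AE; exists x.
have : @unit_sphere R n (A *m x) by [].
rewrite -AE => -[y Ey /(congr1 (mulmx (invmx A)))].
by rewrite !mulKmx // => <-.
Qed.

Lemma hull_ellipsoid_le x : convex_hull E x -> dot (A *m x) (A *m x) <= 1.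
Proof.
move=> Ex; apply: (Ex [set x | dot (A *m x) (A *m x) <= 1]); split=> /=.
  apply/convex_setE => y z t /= yy zz t0 t1.
  rewrite mulmxDr -!scalemxAr; move: (A *m y) (A *m z) yy zz => {}y {}z yy zz.
  have := dot_ge0 (y - z).
  rewrite !dotDl !dotDr !dotNl !dotNr !dotZl !dotZr (dotC z y) => h.
  have t10 : 0 <= 1 - t by rewrite subr_ge0.
  have := mulr_ge0 t0 t10; nra.
by move=> y /= /ellipsoidE ->.
Qed.

Lemma hull_ellipsoid_ge x : (0 < n)%N ->
  dot (A *m x) (A *m x) <= 1 -> convex_hull E x.
Proof.
move=> n0 Ax1.
(* [E] is symmetric, and t y is the combination of y and - y with weight (1 + t) / 2 on y. *)
have seg y t : E y -> 0 <= t -> t <= 1 -> convex_hull E (t *: y).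
  move=> Ey t0 t1 C [/convex_setE cC EC].
  have ENy : E (- y).
    by apply/ellipsoidE; rewrite mulmxN dotNl dotNr opprK; exact/ellipsoidE.
  have := cC _ _ ((1 + t) / 2) (EC _ Ey) (EC _ ENy).
  have -> : ((1 + t) / 2) *: y + (1 - (1 + t) / 2) *: - y = t *: y.
    by apply/matrixP => i j; rewrite !mxE; lra.
  by apply; lra.
have norm z : z != 0 -> E ((Num.sqrt (dot (A *m z) (A *m z)))^-1 *: z).
  move=> z0; have Az : 0 < dot (A *m z) (A *m z).
    apply: dot_gt0; apply: contra z0 => /eqP/(congr1 (mulmx (invmx A))).
    by rewrite mulKmx // mulmx0 => ->.
  apply/ellipsoidE; rewrite -scalemxAr dotZl dotZr mulrA -invfM -expr2.
  by rewrite sqr_sqrtr ?(ltW Az) // mulVf // gt_eqF.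
(* The origin is 0 times any point of [E]; the all-ones vector, nonzero as n > 0, supplies a
   direction for one. *)
have [->|x0] := eqVneq x 0.
  have z0 : const_mx 1 != 0 :> 'cV[R]_n.
    by apply/eqP => /matrixP/(_ (Ordinal n0) ord0)/eqP; rewrite !mxE oner_eq0.
  by have := seg _ 0 (norm _ z0); rewrite scale0r; apply.
have := seg _ (Num.sqrt (dot (A *m x) (A *m x))) (norm _ x0).
rewrite scalerA divff ?scale1r; last first.
  rewrite gt_eqF // sqrtr_gt0 dot_gt0 //; apply: contra x0.
  by move=> /eqP/(congr1 (mulmx (invmx A))); rewrite mulKmx // mulmx0 => ->.
apply; first exact: sqrtr_ge0.
by rewrite -sqrtr1 ler_wsqrtr.
Qed.

End Ellipsoid.

(** * The tight simplex attached to a flag *)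

Section FlagConstruction.
Variables (R : realType) (n : nat) (A : 'M[R]_n).
Hypothesis posA : symmetric_posdef A.
Implicit Types (x y P : 'cV[R]_n).

(** The positive root t of |A (P + t x)|^2 = 1, a quadratic equation in t, when A x is nonzero and
    |A P| < 1. *)
Definition flag_step P x : R :=
  let al := dot (A *m x) (A *m x) in
  let be := dot (A *m P) (A *m x) in
  (Num.sqrt (be ^+ 2 + al * (1 - dot (A *m P) (A *m P))) - be) / al.

(* [flag_base a k] spans, together with height 1, the orthogonal complement of
   the first k lifted vertices in span (a_0, ..., a_(k-1)) + R. *)
Fixpoint flag_base (a : nat -> 'cV[R]_n) (k : nat) : 'cV[R]_n :=
  if k is k'.+1 then
    let P := flag_base a k' in
    P - ((1 + bdot A P P) / flag_step P (a k')) *: a k'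
  else 0.

Definition flag_vertex (a : nat -> 'cV[R]_n) (k : nat) : 'cV[R]_n :=
  flag_base a k + flag_step (flag_base a k) (a k) *: a k.

Lemma symA : A^T = A. Proof. by case: posA. Qed.

Lemma bdot_ge0 x : 0 <= bdot A x x.
Proof.
have [->|x0] := eqVneq x 0; first by rewrite bdot0r.
by rewrite ltW // bdot_gt0.
Qed.

Lemma dotAA_comb x y (t : R) :
  dot (A *m (x + t *: y)) (A *m (x + t *: y)) =
  dot (A *m x) (A *m x) + 2 * t * dot (A *m x) (A *m y)
    + t ^+ 2 * dot (A *m y) (A *m y).
Proof.
rewrite mulmxDr -scalemxAr !dotDl !dotDr !dotZl !dotZr (dotC (A *m y) (A *m x)).
by ring.
Qed.

Lemma flag_step_spec P x : 0 < dot (A *m x) (A *m x) ->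
  dot (A *m P) (A *m P) < 1 ->
  0 < flag_step P x /\
  dot (A *m (P + flag_step P x *: x)) (A *m (P + flag_step P x *: x)) = 1.
Proof.
rewrite dotAA_comb /flag_step.
move: (dot (A *m x) _) (dot (A *m P) (A *m x)) (dot (A *m P) _) => al be c al0 c1.
have disc : 0 <= be ^+ 2 + al * (1 - c).
  by rewrite addr_ge0 ?sqr_ge0 // mulr_ge0 ?ltW // subr_gt0.
split.
  rewrite divr_gt0 // subr_gt0; have [be0|be0] := ltP be 0.
    by rewrite (lt_le_trans be0) ?sqrtr_ge0.
  have lt2 : be ^+ 2 < be ^+ 2 + al * (1 - c).
    by rewrite ltrDl mulr_gt0 // subr_gt0.
  have {1}-> : be = Num.sqrt (be ^+ 2) by rewrite sqrtr_sqr ger0_norm.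
  rewrite ltr_sqrt //.
  exact: le_lt_trans (sqr_ge0 be) lt2.
set s := Num.sqrt _; have ss : s ^+ 2 = be ^+ 2 + al * (1 - c) by rewrite sqr_sqrtr.
apply/eqP; rewrite -subr_eq0; apply/eqP.
have -> : c + 2 * ((s - be) / al) * be + ((s - be) / al) ^+ 2 * al - 1 =
    (s ^+ 2 - be ^+ 2 - al * (1 - c)) / al by field; rewrite gt_eqF.
by rewrite ss; field; rewrite gt_eqF.
Qed.

Lemma flag_step_unique P x (t : R) : 0 < dot (A *m x) (A *m x) ->
  dot (A *m P) (A *m P) < 1 -> 0 < t ->
  dot (A *m (P + t *: x)) (A *m (P + t *: x)) = 1 -> t = flag_step P x.
Proof.
move=> al0 c1 t0; have [] := flag_step_spec al0 c1.
rewrite !dotAA_comb; move: (flag_step P x) al0 c1 => s.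
move: (dot (A *m x) _) (dot (A *m P) (A *m x)) (dot (A *m P) _) => al be c al0 c1.
move=> s0 sE tE; apply/eqP; rewrite -subr_eq0.
have : (t - s) * (al * (t + s) + 2 * be) = 0.
  rewrite (_ : _ * _ = (c + 2 * t * be + t ^+ 2 * al)
    - (c + 2 * s * be + s ^+ 2 * al)); last by ring.
  by rewrite sE tE subrr.
move=> /eqP; rewrite mulf_eq0 => /orP[//|/eqP E].
(* The equation for t gives t (al t + 2 be) = 1 - c > 0, so the second factor cannot vanish. *)
have : 0 < t * (al * (t + s) + 2 * be).
  have : 0 < t * s * al by rewrite !mulr_gt0.
  by nra.
by rewrite E mulr0 ltxx.
Qed.

Section Frame.
Variable a : nat -> 'cV[R]_n.
Hypothesis a_orth : forall i j, (i < n)%N -> (j < n)%N ->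
  bdot A (a i) (a j) = (i == j)%:R.
Hypothesis a_out : a n = 0.
Hypothesis a_trace : \sum_(i < n) dot (A *m a i) (A *m a i) = 1.
Let P := flag_base a.
Let v := flag_vertex a.
Let tau k := flag_step (P k) (a k).
Let al k := dot (A *m a k) (A *m a k).
Let rest k := 1 - \sum_(i < k) al i.

Lemma frame_al_gt0 k : (k < n)%N -> 0 < al k.
Proof.
move=> kn; apply: dot_gt0; apply/eqP => Aa.
have := a_orth kn kn; rewrite /bdot Aa dot0r eqxx => /eqP.
by rewrite eq_sym oner_eq0.
Qed.

Lemma rest_gt0 k : (k < n)%N -> 0 < rest k.
Proof.
move=> kn; rewrite /rest -a_trace -!(big_mkord xpredT (fun i => al i)).
rewrite (big_cat_nat _ (n := k)) ?(ltnW kn) //= addrAC subrr add0r big_ltn //.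
rewrite ltr_wpDr ?frame_al_gt0 // sumr_ge0 // => i _; exact: dot_ge0.
Qed.

Lemma flag_base_orth k j : (k <= j < n)%N -> bdot A (P k) (a j) = 0.
Proof.
elim: k => [|k IH] /andP[kj jn]; first by rewrite bdotC ?symA ?bdot0r.
rewrite /P /= -/P bdotDl IH ?(ltnW kj) //.
rewrite -scaleNr bdotZl a_orth ?(ltn_trans kj) //.
by rewrite (ltn_eqF kj) mulr0 addr0.
Qed.

(* The value of the form |A x|^2 - h^2 at the k-th lifted base point, divided by
   its squared length, is minus the part of the trace not used yet. *)
Lemma flag_base_rest k : (k <= n)%N ->
  1 - dot (A *m P k) (A *m P k) = (1 + bdot A (P k) (P k)) * rest k.
Proof.
elim: k => [|k IH] kn.
  by rewrite /P /= mulmx0 bdot0r dot0r /rest big_ord0 !subr0 addr0 mulr1.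
have IHk := IH (ltnW kn).
have al0 := frame_al_gt0 kn; have r0 := rest_gt0 kn.
have sig0 : 0 < 1 + bdot A (P k) (P k) by rewrite ltr_wpDr ?bdot_ge0.
have c1 : dot (A *m P k) (A *m P k) < 1 by rewrite -subr_gt0 IHk mulr_gt0.
have [tau0 tauE] := flag_step_spec al0 c1.
rewrite /P /= -/P -/(tau k) -scaleNr; rewrite -/(tau k) in tau0 tauE.
rewrite dotAA_comb bdotDl !bdotDr !bdotZl !bdotZr a_orth // eqxx.
rewrite (bdotC (a k)) ?symA // flag_base_orth ?leqnn ?kn //.
have -> : rest k.+1 = rest k - al k by rewrite /rest big_ord_recr /= opprD addrA.
move: tauE IHk; rewrite dotAA_comb -/(al k).
move: (bdot A (P k) (P k)) (dot (A *m P k) (A *m P k)) (dot _ (A *m a k)) (tau k)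
  (al k) (rest k) tau0 sig0 => b c be t x r t0 b0 E1 E2.
(* The induction hypothesis eliminates c = |A P_k|^2 and the isotropy of v_k eliminates be = <A P_k,
   A a_k>; what remains is a rational identity. *)
have cE : c = 1 - (1 + b) * r by rewrite -E2; ring.
have beE : be = ((1 + b) * r - t ^+ 2 * x) / (2 * t).
  move: E1; rewrite cE => E1; apply: (canRL (mulfK _)); last by lra.
  by rewrite mulf_neq0 ?gt_eqF.
by rewrite (_ : true%:R = 1) // cE beE; field; rewrite gt_eqF.
Qed.

Lemma flag_base_lt1 k : (k < n)%N -> dot (A *m P k) (A *m P k) < 1.
Proof.
move=> kn; rewrite -subr_gt0 flag_base_rest ?(ltnW kn) // mulr_gt0 ?rest_gt0 //.
by rewrite ltr_wpDr ?bdot_ge0.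
Qed.

Lemma flag_vertexn : v n = P n.
Proof. by rewrite /v /flag_vertex a_out scaler0 addr0. Qed.

Lemma flag_vertex_norm k : (k <= n)%N -> dot (A *m v k) (A *m v k) = 1.
Proof.
rewrite leq_eqVlt => /orP[/eqP ->|kn]; last first.
  by have [] := flag_step_spec (frame_al_gt0 kn) (flag_base_lt1 kn).
(* At k = n the trace is used up, so the last base point is isotropic by itself and needs no further
   step. *)
rewrite flag_vertexn; have := flag_base_rest (leqnn n).
by rewrite /rest a_trace subrr mulr0 => /eqP; rewrite subr_eq0 => /eqP <-.
Qed.

Lemma flag_vertex_frame k j : (k <= n)%N -> (k <= j < n)%N ->
  bdot A (v k) (a j) = if j == k then tau k else 0.
Proof.
move=> kn /andP[kj jn]; rewrite bdotDl flag_base_orth ?kj // add0r bdotZl.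
by rewrite a_orth ?(leq_ltn_trans kj) // eq_sym; case: eqP; rewrite ?mulr1 ?mulr0.
Qed.

Lemma flag_step_gt0 k : (k < n)%N -> 0 < tau k.
Proof.
by move=> kn; have [] := flag_step_spec (frame_al_gt0 kn) (flag_base_lt1 kn).
Qed.

(** The coefficient of a_i in P_(i+1) is chosen for this value: <P_i, P_i> - (1 + <P_i, P_i>) = -1.
    Later base points add multiples of a_k with k > i, which are orthogonal to v_i. *)
Lemma flag_vertex_base i k : (i < k <= n)%N -> bdot A (v i) (P k) = -1.
Proof.
elim: k => // k IH /andP[]; rewrite ltnS leq_eqVlt => /orP[/eqP ->|ik] kn.
  rewrite /P /= -/P bdotDr -scaleNr bdotZr flag_vertex_frame ?leqnn ?(ltnW kn) //.
  rewrite eqxx /v /flag_vertex -/P bdotDl bdotZl (bdotC (a k)) ?symA //.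
  rewrite flag_base_orth ?leqnn // -/(tau k); field.
  by rewrite gt_eqF // flag_step_gt0.
rewrite /P /= -/P bdotDr -scaleNr bdotZr IH ?ik ?(ltnW kn) //.
rewrite flag_vertex_frame ?(ltnW ik) ?kn //; last by rewrite ltnW // (ltn_trans ik).
by rewrite (gtn_eqF ik) mulr0 addr0.
Qed.

Lemma flag_vertex_neq i j : (i <= n)%N -> (j <= n)%N -> i != j ->
  bdot A (v i) (v j) = -1.
Proof.
wlog ij : i j / (i < j)%N => [H|] in_ jn nij.
  by have [ij|ji|/eqP] := ltngtP i j;
    [exact: H|rewrite bdotC ?symA //; apply: H; rewrite // eq_sym|rewrite (negPf nij)].
move: jn; rewrite leq_eqVlt => /orP[/eqP jE|jn].
  by rewrite jE flag_vertexn flag_vertex_base // -jE ij leqnn.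
rewrite {2}/v /flag_vertex -/P bdotDr bdotZr flag_vertex_base ?ij ?(ltnW jn) //.
by rewrite flag_vertex_frame ?(ltnW ij) // (gtn_eqF ij) mulr0 addr0.
Qed.

Lemma flag_base_span k x : (k <= n)%N ->
  (forall j, (j < k)%N -> bdot A (a j) x = 0) -> bdot A (P k) x = 0.
Proof.
elim: k => [|k IH] kn H; first by rewrite /P /= bdotC ?symA // bdot0r.
rewrite /P /= -/P bdotDl -scaleNr bdotZl H // mulr0 addr0 IH ?(ltnW kn) // => j jk.
by apply: H; rewrite ltnW.
Qed.

(** The v_i are triangular in the a_j with diagonal coefficients tau_i > 0, so orthogonality passes
    from the first family to the second. *)
Lemma flag_frame_span k x : (k <= n)%N ->
  (forall i, (i < k)%N -> bdot A (v i) x = 0) ->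
  forall j, (j < k)%N -> bdot A (a j) x = 0.
Proof.
move=> kn H j; have [m] := ubnP j; elim: m j => // m IH j /ltnSE jm jk.
have jn := leq_trans jk kn.
have := H _ jk; rewrite bdotDl bdotZl flag_base_span ?(ltnW jn) //; last first.
  by move=> i ij; exact: (IH i (leq_trans ij jm) (ltn_trans ij jk)).
rewrite add0r => /eqP; rewrite mulf_eq0 => /orP[|/eqP //].
by rewrite gt_eqF // flag_step_gt0.
Qed.

Hypothesis a_basis : forall x, (forall j, (j < n)%N -> bdot A (a j) x = 0) -> x = 0.

(** The pairings leave x - P_k no component except along a_k. If k < n, isotropy then fixes the
    coefficient as the positive root; if k = n, a_n is 0. *)
Lemma flag_vertex_unique k x : (k <= n)%N ->
  (forall i, (i < k)%N -> bdot A (v i) x = -1) ->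
  (forall j, (k < j < n)%N -> bdot A (a j) x = 0) ->
  ((k < n)%N -> 0 < bdot A (a k) x) ->
  dot (A *m x) (A *m x) = 1 -> x = v k.
Proof.
move=> kn xv xa xk xx; set t := bdot A (a k) x.
have aP j : (k <= j < n)%N -> bdot A (a j) (P k) = 0.
  by move=> kj; rewrite bdotC ?symA // flag_base_orth.
have xE : x = P k + t *: a k.
  apply/eqP; rewrite -subr_eq0; apply/eqP; apply: a_basis => j jn.
  rewrite bdotBr bdotDr bdotZr; have [jk|kj|jk] := ltngtP j k.
  - have kn' : t * bdot A (a j) (a k) = 0.
      move: kn; rewrite leq_eqVlt => /orP[/eqP ->|kn'].
        by rewrite a_out bdot0r mulr0.
      by rewrite a_orth // (ltn_eqF jk) mulr0.
    rewrite kn' addr0 -bdotBr; apply: flag_frame_span jk => // i ik.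
    by rewrite bdotBr xv // flag_vertex_base ?ik // subrr.
  - rewrite xa ?kj // aP ?(ltnW kj) // a_orth ?(ltn_trans kj) // (gtn_eqF kj).
    by rewrite mulr0 addr0 subr0.
  - by rewrite jk in jn *; rewrite aP ?leqnn // a_orth // eqxx mulr1 add0r subrr.
move: kn; rewrite leq_eqVlt => /orP[/eqP kE|kn].
  by rewrite xE /v /flag_vertex kE a_out !scaler0.
rewrite /v /flag_vertex xE; congr (_ + _ *: _).
apply: flag_step_unique (frame_al_gt0 kn) (flag_base_lt1 kn) (xk kn) _.
by rewrite -xE.
Qed.

End Frame.

End FlagConstruction.

(** * Fitting simplices and their frames *)

Section FittingSimplices.
Variables (R : realType) (n : nat).
Hypothesis n0 : (0 < n)%N.
Implicit Types (A Q : 'M[R]_n) (V : 'M[R]_(n, n.+1)).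

(** When [\tr A = 1] these equations single out exactly the fitting simplices, in the form that
    [flag_vertex_unique] can solve. *)
Definition tight_gram A V :=
  (forall i j, i != j -> bdot A (col i V) (col j V) = -1) /\
  forall i, dot (A *m col i V) (A *m col i V) = 1.

Lemma fitting_coords A E V : A \in unitmx ->
    [set A *m x | x in E] = @unit_sphere R n ->
  fitting_simplices (@unit_sphere R n) E V <->
  exists W l, [/\ barycentric V W l,
    forall i, 0 < l i ord0 /\
      dot (coord_vec W i) (coord_vec W i) <= l i ord0 ^+ 2 &
    forall i, dot (A *m col i V) (A *m col i V) <= 1].
Proof.
move=> uA AE; split=> [[labV [SV VE]]|[W [l [bary wl Av]]]].
  have [W [l bary]] := labeled_barycentric labV.
  exists W, l; split=> //; first exact: (sphere_hull_coord bary n0 SV).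
  by move=> i; apply: (hull_ellipsoid_le uA AE); apply: VE; exact: hull_col bary i.
split; first by apply: (barycentric_labeled bary) => i; have [] := wl i.
split; first by apply: (sphere_sub_hull bary) => i; have [] := wl i.
by apply: convex_hullS => _ [j _ <-]; exact: (hull_ellipsoid_ge uA AE n0 (Av j)).
Qed.

(** A basis orthogonal for A + 1 has an explicit dual basis: with d_i = 1 + <v_i, A v_i>, the
    squared length of (v_i, 1), one gets l_i = 1 / d_i and w_i = A v_i / d_i. *)
Lemma tight_gram_coords A V : symmetric_posdef A -> tight_gram A V ->
  exists W l, [/\ barycentric V W l, forall i, 0 < l i ord0 &
    forall i, dot (coord_vec W i) (coord_vec W i) = l i ord0 ^+ 2].
Proof.
move=> posA [Vij Vi].
pose d i := 1 + bdot A (col i V) (col i V).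
have d0 i : 0 < d i by rewrite ltr_wpDr ?bdot_ge0.
exists (\matrix_(i, j) ((d i)^-1 * (A *m col i V) j ord0)), (\col_i (d i)^-1).
split=> [|i|i].
- apply: left_inverse_barycentric; apply/matrixP => i j.
  rewrite !mxE big_ord1 !mxE mulr1.
  have -> : \sum_k (\matrix_(i, j) ((d i)^-1 * (A *m col i V) j ord0)) i k * V k j
      = (d i)^-1 * bdot A (col i V) (col j V).
    rewrite bdotC; last by case: posA.
    rewrite /bdot dotC dotE mulr_sumr; apply: eq_bigr => k _.
    by rewrite mxE [col j V k _]mxE mulrA.
  have [->|ij] := eqVneq i j; last by rewrite Vij // mulrN1 addNr.
  by rewrite -{2}[(d j)^-1]mulr1 -mulrDr addrC mulVf // gt_eqF.
- by rewrite mxE invr_gt0.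
have -> : coord_vec (\matrix_(i, j) ((d i)^-1 * (A *m col i V) j ord0)) i =
    (d i)^-1 *: (A *m col i V).
  by apply/matrixP => a b; rewrite !mxE (ord1 b).
by rewrite dotZl dotZr Vi mulr1 mxE expr2.
Qed.

(** Equality in the trace bound gives w_i = l_i A v_i; the vanishing of coordinate i at v_j then
    reads l_i (1 + <A v_i, v_j>) = 0. *)
Lemma fitting_tight_gram A V W (l : 'cV[R]_n.+1) : A^T = A -> \tr A = 1 ->
  barycentric V W l ->
  (forall i, 0 < l i ord0 /\
      dot (coord_vec W i) (coord_vec W i) <= l i ord0 ^+ 2) ->
  (forall i, dot (A *m col i V) (A *m col i V) <= 1) ->
  tight_gram A V.
Proof.
move=> symA trA bary wl Av; have [_] := trace_le1 bary wl Av.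
rewrite trA eqxx => /esym/forallP eqs; split=> [i j ij|i]; last first.
  by have /andP[_ /eqP] := eqs i.
have /andP[/eqP wE _] := eqs i; have [l0 _] := wl i.
have := barycentric_col bary j i.
rewrite barycentricE wE (negPf ij) dotZl => /eqP.
rewrite -{1}[l i ord0]mulr1 -mulrDr mulf_eq0 gt_eqF //=.
by rewrite addrC addr_eq0 dot_mulmxl symA => /eqP.
Qed.

(** As V l = 0, the right inverse [W] can be corrected by a multiple of [l] to have last row 0; its
    other rows then invert the first n columns. *)
Lemma frame_unitmx V W (l : 'cV[R]_n.+1) : barycentric V W l ->
  0 < l ord_max ord0 -> col' ord_max V \in unitmx.
Proof.
move=> [VW Vl _ _ _] l0; set lm := l ord_max ord0 in l0.
pose Z := W - lm^-1 *: (l *m row ord_max W).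
have VZ : V *m Z = 1%:M.
  by rewrite mulmxBr VW -scalemxAr mulmxA Vl mul0mx scaler0 subr0.
have Zm j : Z ord_max j = 0.
  by rewrite !mxE big_ord1 !mxE -/lm mulrA mulVf ?mul1r ?subrr // gt_eqF.
have : col' ord_max V *m row' ord_max Z = 1%:M.
  rewrite -VZ; apply/matrixP => i j; rewrite !mxE (bigD1_ord ord_max) //= Zm.
  by rewrite mulr0 add0r; apply: eq_bigr => k _; rewrite mxE [X in _ * X]mxE.
by case/mulmx1_unit.
Qed.

(* The value 0 at k = n makes the last vertex equal to [flag_base], the division
   by 0 in [flag_step] being multiplied by 0. *)
Definition frame_col A Q (k : nat) : 'cV[R]_n :=
  if insub k is Some j then col j (gs A Q) else 0.

Definition simplex_of_frame A Q : 'M[R]_(n, n.+1) :=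
  \matrix_(i, j) flag_vertex A (frame_col A Q) j i ord0.

Lemma frame_colE A Q (k : 'I_n) : frame_col A Q k = col k (gs A Q).
Proof. by rewrite /frame_col valK. Qed.

Lemma frame_col_ord A Q k (kn : (k < n)%N) :
  frame_col A Q k = col (Ordinal kn) (gs A Q).
Proof. by rewrite -frame_colE. Qed.

Lemma frame_col_out A Q : frame_col A Q n = 0.
Proof. by rewrite /frame_col insubN // ltnn. Qed.

Lemma col_simplex_of_frame A Q j :
  col j (simplex_of_frame A Q) = flag_vertex A (frame_col A Q) j.
Proof. by apply/matrixP => a b; rewrite ord1 !mxE. Qed.

Lemma frame_col_orth A Q : symmetric_posdef A -> Q \in unitmx ->
  forall i j, (i < n)%N -> (j < n)%N ->
  bdot A (frame_col A Q i) (frame_col A Q j) = (i == j)%:R.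
Proof.
move=> posA uQ i j ni nj; rewrite !frame_col_ord bdot_col gs_orthonormal //.
by rewrite mxE.
Qed.

(** An A-orthonormal frame X satisfies A X X^T = 1, so tr(X^T A A X) = tr A. *)
Lemma frame_col_trace A Q : symmetric_posdef A -> Q \in unitmx -> \tr A = 1 ->
  \sum_(i < n) dot (A *m frame_col A Q i) (A *m frame_col A Q i) = 1.
Proof.
move=> posA uQ <-; have := gs_orthonormal posA uQ; set X := gs A Q => XX.
have AXX : A *m X *m X^T = 1%:M by rewrite -mulmxA in XX; exact: mulmx1C XX.
rewrite -[A in RHS]mulmx1 -AXX -!mulmxA (mulmxA A) mulmxA mxtrace_mulC.
apply: eq_bigr => i _; rewrite frame_colE -/X dot_mulmxl symA //.
by rewrite -[LHS]/(dot _ _) mulmxA -/(bdot _ _ _) bdot_col !mulmxA.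
Qed.

Lemma frame_col_basis A Q : symmetric_posdef A -> Q \in unitmx ->
  forall x, (forall j, (j < n)%N -> bdot A (frame_col A Q j) x = 0) -> x = 0.
Proof.
move=> posA uQ x H; have := gs_orthonormal posA uQ; set X := gs A Q => XX.
have XAx : X^T *m A *m x = 0.
  apply/matrixP => i j; rewrite ord1 [RHS]mxE -(H i (ltn_ord i)) frame_colE.
  by rewrite /bdot /dot tr_col mulmxA -!row_mul [RHS]mxE.
by rewrite -[x]mul1mx -(mulmx1C XX) -mulmxA XAx mulmx0.
Qed.

Section Frame.
Variable A : 'M[R]_n.
Hypothesis posA : symmetric_posdef A.
Hypothesis trA : \tr A = 1.

Lemma simplex_of_frame_tight Q : Q \in unitmx -> tight_gram A (simplex_of_frame A Q).
Proof.
move=> uQ; have orth := frame_col_orth posA uQ.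
have out := frame_col_out A Q; have tr1 := frame_col_trace posA uQ trA.
split=> [i j ij|i]; rewrite !col_simplex_of_frame.
  by apply: (flag_vertex_neq posA orth out tr1); rewrite ?val_eqE // -ltnS.
by apply: (flag_vertex_norm posA orth out tr1); rewrite -ltnS.
Qed.

Lemma simplex_of_frame_uptri Q : Q \in unitmx ->
  uptri_pos ((gs A Q)^T *m A *m col' ord_max (simplex_of_frame A Q)).
Proof.
move=> uQ; have orth := frame_col_orth posA uQ.
have out := frame_col_out A Q; have tr1 := frame_col_trace posA uQ trA.
have colE (j : 'I_n) : col j (col' ord_max (simplex_of_frame A Q)) =
    flag_vertex A (frame_col A Q) j.
  by apply/matrixP => a b; rewrite !mxE lift_max (ord1 b).
split=> [i j ji|i]; rewrite -bdot_col colE -frame_colE (bdotC _ _ (symA posA)).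
  rewrite (flag_vertex_frame posA orth) ?(ltnW (ltn_ord j)) ?(ltnW ji) ?ltn_ord //.
  by rewrite (gtn_eqF ji).
rewrite (flag_vertex_frame posA orth) ?(ltnW (ltn_ord i)) ?leqnn ?ltn_ord // eqxx.
exact: (flag_step_gt0 posA orth tr1).
Qed.

(** By [gs_unique] it suffices that Q^T M is triangular with positive diagonal, M being the first n
    columns. With X = gs A Q it factors as (Q^T X) (X^T A M), and Q^T X is the inverse of X^T A
    Q. *)
Lemma simplex_frameK Q : @orthogonal_group R n Q ->
  simplex_frame (simplex_of_frame A Q) = Q.
Proof.
rewrite /orthogonal_group /= => QQ.
have uQ : Q \in unitmx by case/mulmx1_unit: QQ.
rewrite /simplex_frame gram_schmidtE; apply: gs_unique; rewrite mulmx1 //.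
have tri := simplex_of_frame_uptri uQ; have XX := gs_orthonormal posA uQ.
set X := gs A Q in tri XX.
have XAX : X *m (X^T *m A) = 1%:M by exact: mulmx1C.
rewrite -[col' _ _]mul1mx -XAX -(mulmxA X) (mulmxA Q^T X).
apply: (uptri_pos_mul _ tri).
apply: (uptri_pos_inv (gs_uptri posA uQ)); rewrite -/X.
rewrite mulmxA -(mulmxA Q^T) XAX mulmx1; exact: QQ.
Qed.

(** The vertices are identified in order by [flag_vertex_unique]. Its sign and vanishing conditions
    are the triangularity of X^T A M = (X^T A Q) (Q^T M). *)
Lemma simplex_of_frameK V : tight_gram A V -> col' ord_max V \in unitmx ->
  simplex_of_frame A (simplex_frame V) = V.
Proof.
move=> [Vij Vi] uV; set M := col' ord_max V in uV.
set Q := simplex_frame V.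
have QE : Q = gs 1%:M M by rewrite /Q /simplex_frame gram_schmidtE.
have QQ : Q^T *m Q = 1%:M.
  by have := gs_orthonormal (symmetric_posdef1 R n) uV; rewrite -QE mulmx1.
have uQ : Q \in unitmx by case/mulmx1_unit: QQ.
have orth := frame_col_orth posA uQ.
have out := frame_col_out A Q; have tr1 := frame_col_trace posA uQ trA.
have triQ : uptri_pos (Q^T *m M).
  by have := gs_uptri (symmetric_posdef1 R n) uV; rewrite -QE mulmx1.
have [tri0 tripos] : uptri_pos ((gs A Q)^T *m A *m M).
  rewrite -[M]mul1mx -(mulmx1C QQ) -(mulmxA Q) mulmxA.
  exact: uptri_pos_mul (gs_uptri posA uQ) triQ.
have colM (i : 'I_n) (k : 'I_n.+1) (kn : (k < n)%N) :
    ((gs A Q)^T *m A *m M) i (Ordinal kn) = bdot A (frame_col A Q i) (col k V).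
  rewrite -bdot_col -frame_colE; congr bdot; apply/matrixP => a b.
  by rewrite !mxE; congr (V _ _); apply/ord_inj; rewrite lift_max.
suff vE (k : 'I_n.+1) : col k V = flag_vertex A (frame_col A Q) k.
  apply/matrixP => i j; rewrite mxE -vE mxE.
  by [].
have [m] := ubnP (k : nat); elim: m k => // m IH k /ltnSE km.
apply: (flag_vertex_unique posA orth out tr1 (frame_col_basis posA uQ)).
- by rewrite -ltnS.
- move=> i ik; have i1 : (i < n.+1)%N by rewrite (ltn_trans ik).
  rewrite -[i]/(nat_of_ord (Ordinal i1)) -IH ?(leq_trans ik km) // Vij //.
  by apply/eqP => E; rewrite -E /= ltnn in ik.
- move=> j /andP[kj jn]; have kn := ltn_trans kj jn.
  by rewrite -[j]/(nat_of_ord (Ordinal jn)) -(colM _ _ kn) tri0.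
- by move=> kn; rewrite -{1}[nat_of_ord k]/(nat_of_ord (Ordinal kn)) -colM.
- exact: Vi.
Qed.

(** The invertible matrices form the open neighbourhood of O(n) that [smooth_on] asks for, and all
    radicands and denominators are positive on it. *)
Lemma mx_elementary_simplex_of_frame :
  mx_elementary [set Q : 'M[R]_n | Q \in unitmx] (simplex_of_frame A).
Proof.
set U := [set Q : 'M[R]_n | _].
have eX : mx_elementary U (gs A).
  exact: (mx_elementary_gs posA (F := id) (fun x Ux => Ux) (mx_elementary_id U)).
have ea k : mx_elementary U (fun Q => frame_col A Q k).
  rewrite /frame_col; case: insubP => [j _ _|_]; last exact: mx_elementary_cst.
  by move=> a b; apply: elem_ext (eX a j) => Q _; rewrite [RHS]mxE.
have emul (F : 'M[R]_n -> 'cV[R]_n) : mx_elementary U F ->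
    mx_elementary U (fun Q => A *m F Q).
  by move=> eF; apply: mx_elementary_mul => //; exact: mx_elementary_cst.
have estep k : (k < n)%N ->
    mx_elementary U (fun Q => flag_base A (frame_col A Q) k) ->
    elementary U (fun Q => flag_step A (flag_base A (frame_col A Q) k) (frame_col A Q k)).
  move=> kn eP; rewrite /flag_step.
  have al0 Q : U Q -> 0 < dot (A *m frame_col A Q k) (A *m frame_col A Q k).
    by move=> uQ; exact: (frame_al_gt0 (frame_col_orth posA uQ)).
  apply: elem_mul; last first.
    by apply: elem_inv; [move=> Q /al0/gt_eqF ->|apply: elem_dot; apply: emul].
  apply: elem_add; last by apply: elem_opp; apply: elem_dot; apply: emul.
  apply: elem_sqrt => [Q uQ|].
    rewrite ltr_wpDl ?sqr_ge0 // mulr_gt0 ?al0 // subr_gt0.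
    exact: (flag_base_lt1 posA (frame_col_orth posA uQ) (frame_col_trace posA uQ trA)).
  apply: elem_add; first by apply: elem_mul; apply: elem_dot; apply: emul.
  apply: elem_mul; first by apply: elem_dot; apply: emul.
  apply: elem_add; first exact: elem_cst.
  by apply: elem_opp; apply: elem_dot; apply: emul.
have eP k : (k <= n)%N -> mx_elementary U (fun Q => flag_base A (frame_col A Q) k).
  elim: k => [|k IH] kn /=; first exact: mx_elementary_cst.
  have IHk := IH (ltnW kn).
  apply: mx_elementary_add => //; apply: mx_elementary_opp.
  apply: mx_elementary_scale => //; apply: elem_mul.
    by apply: elem_add; [exact: elem_cst|apply: elem_dot => //; exact: emul].
  apply: elem_inv; last exact: estep.
  move=> Q uQ; rewrite gt_eqF //.
  exact: (flag_step_gt0 posA (frame_col_orth posA uQ) (frame_col_trace posA uQ trA)).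
have ev k : (k <= n)%N -> mx_elementary U (fun Q => flag_vertex A (frame_col A Q) k).
  (* At k = n the denominator of [flag_step] is 0, so the last vertex is treated as a base point. *)
  move=> kn a b; have := kn; rewrite leq_eqVlt => /orP[/eqP kE|kn'].
    apply: elem_ext (eP k kn a b) => Q _.
    by rewrite /flag_vertex kE frame_col_out scaler0 addr0.
  have : mx_elementary U (fun Q => flag_vertex A (frame_col A Q) k).
    apply: mx_elementary_add; first exact: eP.
    by apply: mx_elementary_scale => //; apply: estep => //; exact: eP.
  exact.
move=> i j; have jn : (j <= n)%N by rewrite -ltnS.
by apply: elem_ext (ev j jn i ord0) => Q _; rewrite [RHS]mxE.
Qed.

End Frame.

End FittingSimplices.

(** * The three cases according to the trace of [A] *)

Theorem theorem3 (R : realType) (n : nat) (hn : (1 <= n)%N)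
    (Ein Eout : set 'cV[R]_n)
    (hEin : Ein = @unit_sphere R n)
    (hEout : centered_ellipsoid Eout)
    (A : 'M[R]_n) (hA : symmetric_posdef A)
    (hAE : [set A *m x | x in Eout] = Ein) :
  let Sf := fitting_simplices Ein Eout in
  let St := tight_simplices Ein Eout in
  let phi := @simplex_frame R n in
  let On := @orthogonal_group R n in
  [/\ set_fun Sf On phi,
      (\tr A > 1 -> Sf = set0),
      (\tr A = 1 -> Sf = St /\ diffeomorphism Sf On phi)
    & (\tr A < 1 -> [/\ St <> Sf, set_surj Sf On phi & ~ set_inj Sf phi])].
Proof.
move=> Sf St phi On; have uA := posdef_unitmx hA.
rewrite hEin in hAE; rewrite {}/Sf {}/St hEin.
set Sf := fitting_simplices _ _; set St := tight_simplices _ _.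
have SfP V : Sf V <-> exists W l, [/\ barycentric V W l,
    forall i, 0 < l i ord0 /\
      dot (coord_vec W i) (coord_vec W i) <= l i ord0 ^+ 2 &
    forall i, dot (A *m col i V) (A *m col i V) <= 1].
  exact: (fitting_coords hn V uA hAE).
have Sfunit V : Sf V -> col' ord_max V \in unitmx.
  move=> /SfP[W [l [bary wl _]]].
  by apply: (frame_unitmx bary); have [] := wl ord_max.
have phiOn V : Sf V -> On (phi V).
  move=> /Sfunit uV; rewrite /On /orthogonal_group /phi /simplex_frame /=.
  rewrite gram_schmidtE.
  by have := gs_orthonormal (symmetric_posdef1 R n) uV; rewrite mulmx1.
have OnU Q : On Q -> Q \in unitmx by move=> /mulmx1_unit[].
split=> //.
- move=> tr1; apply/seteqP; split=> // V /SfP[W [l [bary wl Av]]].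
  by have [] := trace_le1 bary wl Av; rewrite leNgt tr1.
- move=> trA.
  have tightP V : Sf V -> tight_gram A V.
    move=> /SfP[W [l [bary wl Av]]]; case: hA => symA _.
    exact: (fitting_tight_gram symA trA bary wl Av).
  have gramSf V : tight_gram A V -> Sf V.
    move=> VA; have [W [l [bary l0 wl]]] := tight_gram_coords hA VA.
    apply/SfP; exists W, l; split=> // i; first by rewrite wl.
    by have [_ ->] := VA.
  split.
    apply/seteqP; split=> V; last by move=> [labV [fitV _ _]].
    move=> SfV; have VA := tightP V SfV; have [labV fitV] := SfV.
    have [W [l [bary l0 wl]]] := tight_gram_coords hA VA.
    split=> //; split=> //; last exact: (circumscribed_sphere bary l0 wl).
    rewrite /inscribed (vertices_hull bary) => _ [j _ <-].
    by apply/(ellipsoidE uA hAE); case: VA.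
  have gSf Q : On Q -> Sf (simplex_of_frame A Q).
    by move=> /OnU uQ; apply: gramSf; exact: simplex_of_frame_tight.
  have phiK V : Sf V -> simplex_of_frame A (phi V) = V.
    by move=> SfV; apply: simplex_of_frameK => //; [exact: tightP|exact: Sfunit].
  have Kphi Q : On Q -> phi (simplex_of_frame A Q) = Q by exact: simplex_frameK.
  split.
  + split=> //; last first.
      by move=> Q OQ; exists (simplex_of_frame A Q); [exact: gSf|exact: Kphi].
    move=> V V' /[!inE] SV SV' E; rewrite -(phiK V) // E phiK //.
  (* [phi] is its own smooth extension, to the open set where the first n columns are
     independent. *)
  + move=> V SV; exists [set M | mxsub id (lift ord_max) M \in unitmx], phi.
    have sE M : col' ord_max M = mxsub id (lift ord_max) M :> 'M[R]_n.
      by apply/matrixP => i j; rewrite !mxE.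
    have oU := @open_unitmx_preimage R n n.+1 n id (lift ord_max).
    split=> //; first by rewrite /= -sE; exact: Sfunit.
    move=> k; apply: mx_elementary_Ck => //.
    have := mx_elementary_gs (symmetric_posdef1 R n)
      (F := fun M : 'M[R]_(n, n.+1) => col' ord_max M)
      (U := [set M | mxsub id (lift ord_max) M \in unitmx]).
    rewrite (_ : (fun M => gs 1%:M (col' ord_max M)) = phi); last first.
      by apply/funext => M; rewrite /phi /simplex_frame gram_schmidtE.
    apply; first by move=> M /=; rewrite sE.
    by move=> i j; apply: elem_ext (elem_coord _ i (lift ord_max j)) => M _; rewrite mxE.
  exists (simplex_of_frame A); first exact: phiK.
  move=> Q OQ; exists [set Q | Q \in unitmx], (simplex_of_frame A).
  have sE (M : 'M[R]_n) : M = mxsub id id M by apply/matrixP => i j; rewrite !mxE.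
  have oU : open [set Q : 'M[R]_n | Q \in unitmx].
    have := @open_unitmx_preimage R n n n id id.
    by rewrite (_ : [set _ | _] = [set Q : 'M[R]_n | Q \in unitmx]) //;
      apply/seteqP; split=> M /=; rewrite -sE.
  split=> //; first exact: OnU.
  by move=> k; apply: mx_elementary_Ck => //; exact: mx_elementary_simplex_of_frame.
move=> trA; have tr0 : 0 < \tr A.
  rewrite /mxtrace; have i0 : 'I_n := Ordinal hn.
  have Aii i : 0 < A i i.
    have : 0 < bdot A (col i 1%:M) (col i 1%:M).
      apply: bdot_gt0 => //; apply/eqP => /matrixP/(_ i ord0)/eqP.
      by rewrite !mxE eqxx oner_eq0.
    by rewrite bdot_col trmx1 mul1mx mulmx1.
  by rewrite (bigD1 i0) //= ltr_wpDr // sumr_ge0 // => i _; exact: ltW.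
set t := \tr A in trA tr0.
(* [B] has trace 1, so every frame has a simplex tight for the ellipsoid |B x| = 1. There |A v| = t
   |B v| = t < 1, which puts its vertices strictly inside [Eout]. *)
pose B := t^-1 *: A.
have posB : symmetric_posdef B.
  case: hA => symA posA; split=> [|x x0]; first by rewrite /B linearZ /= symA.
  by rewrite /B -scalemxAl dotZr mulr_gt0 ?invr_gt0 ?posA.
have trB : \tr B = 1 by rewrite /B linearZ /= mulVf // gt_eqF.
have AB x : A *m x = t *: (B *m x).
  by rewrite /B -scalemxAl scalerA divff ?scale1r // gt_eqF.
pose g := simplex_of_frame B.
have gA Q i : On Q -> dot (A *m col i (g Q)) (A *m col i (g Q)) = t ^+ 2.
  move=> /OnU uQ; have [_ Bv] := simplex_of_frame_tight posB trB uQ.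
  by rewrite AB dotZl dotZr Bv mulr1 expr2.
have t2 : t ^+ 2 < 1 by rewrite expr_lt1 // ltW.
have gSf Q : On Q -> Sf (g Q).
  move=> OQ; have [W [l [bary l0 wl]]] :=
    tight_gram_coords posB (simplex_of_frame_tight posB trB (OnU _ OQ)).
  apply/SfP; exists W, l; split=> // i; first by rewrite wl.
  by rewrite gA // ltW.
have Kphi Q : On Q -> phi (g Q) = Q by exact: simplex_frameK.
have On1 : On 1%:M by rewrite /On /orthogonal_group /= trmx1 mulmx1.
have bary1 : exists W l, barycentric (g 1%:M) W l.
  by have /SfP[W [l [bary _ _]]] := gSf _ On1; exists W, l.
split.
- move=> StSf; have := gSf _ On1; rewrite -StSf => -[_ [_ insc _]].
  have [W [l bary]] := bary1.
  have /insc/(ellipsoidE uA hAE) :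
      vertices (hull_of_columns (g 1%:M)) (col ord0 (g 1%:M)).
    by rewrite (vertices_hull bary); exists ord0.
  by rewrite gA // => tE; rewrite tE ltxx in t2.
- by move=> Q OQ; exists (g Q); [exact: gSf|exact: Kphi].
(* Dilating [V] by 1 / t pushes its vertices out to [Eout] exactly. The result still fits and has
   the same frame, since a positive factor is lost in normalization. *)
move=> phi_inj; pose V := g 1%:M; have [W [l bary]] := bary1.
have SV : Sf V by exact: gSf.
have tV0 : t^-1 != 0 by rewrite invr_eq0 gt_eqF.
have SV' : Sf (t^-1 *: V).
  have /SfP[W' [l' [bary' wl' _]]] := SV.
  (* Under this dilation the coordinates of the origin stay and the linear parts are multiplied by t
     < 1, so the bounds |w_i| <= l_i persist. *)
  apply/SfP; exists (t *: W'), l'; split=> [|i|i].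
  - apply: left_inverse_barycentric; case: bary' => _ _ <- _ _.
    by rewrite -scalemxAl -scalemxAr scalerA divff ?scale1r // gt_eqF.
  - have [l0 wl] := wl' i; split=> //.
    rewrite (_ : coord_vec (t *: W') i = t *: coord_vec W' i); last first.
      by apply/matrixP => a b; rewrite !mxE.
    rewrite dotZl dotZr mulrA -expr2; apply: le_trans wl.
    by rewrite ler_piMl ?dot_ge0 // ltW.
  rewrite (_ : col i _ = t^-1 *: col i V); last first.
    by apply/matrixP => a b; rewrite !mxE.
  rewrite -scalemxAr dotZl dotZr gA // mulrA -invfM -expr2 mulVf //.
  by rewrite expf_neq0 // gt_eqF.
have phiE : phi (t^-1 *: V) = phi V.
  have QQ := phiOn V SV; have uV := Sfunit V SV.
  rewrite {1}/phi /simplex_frame gram_schmidtE; apply: gs_unique.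
    by rewrite mulmx1.
  rewrite linearZ /= -scalemxAr; apply: uptri_pos_scale; first by rewrite invr_gt0.
  rewrite /phi /simplex_frame gram_schmidtE.
  exact: (gs_uptri (symmetric_posdef1 R n) uV).
have := phi_inj _ _ (mem_set SV') (mem_set SV) phiE.
move=> /eqP; rewrite -subr_eq0 -[X in _ - X]scale1r -scalerBl scaler_eq0.
have t1 : t^-1 - 1 != 0.
  by rewrite subr_eq0 -invr1 (inj_eq invr_inj) lt_eqF.
rewrite (negPf t1) /= => /eqP V0; case: bary => VW _ _ _ _.
move: VW; rewrite -/V V0 mul0mx => /matrixP/(_ (Ordinal hn) (Ordinal hn))/eqP.
by rewrite !mxE eqxx eq_sym oner_eq0.
Qed.
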